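(* Every four-dimensional Lie group equipped with a non-flat left-invariant Lorentzian metric which is a pp-wave is isomorphically homothetic to a Lie group with left-invariant Lorentzian metric determined by one of the following metric Lie algebras (all parameters $\gamma_i$ are real numbers, arbitrary except where restricted): (1) $[u_1,u_4]=\gamma_1u_1+u_2-\gamma_3u_3$, $[u_2,u_4]=-\gamma_1u_2$, $[u_3,u_4]=\gamma_3u_2$, with $\gamma_1\neq 0$. (2) $[u_2,u_4]=-(\gamma_2-1)u_3$, $[u_3,u_4]=(\gamma_2+1)u_1$. (3) $[v_1,v_4]=\gamma_1v_1-\gamma_2v_2+\gamma_3v_3$, $[v_2,v_4]=\gamma_2v_1+\gamma_4v_2+\gamma_5v_3$, $[v_3,v_4]=\gamma_8v_3$. (4) $[v_1,v_2]=v_3$, $[v_1,v_4]=\gamma_1v_1-\gamma_2v_2+\gamma_3v_3$, $[v_2,v_4]=\gamma_2v_1+\gamma_4v_2+\gamma_5v_3$, $[v_3,v_4]=(\gamma_1+\gamma_4)v_3$. (5) $[v_1,v_3]=v_2$, $[v_2,v_3]=-v_1$, $[v_1,v_4]=\gamma_1v_1+\gamma_2v_2$, $[v_2,v_4]=-\gamma_2v_1+\gamma_1v_2$, with $\gamma_1\neq 0$. Here $\{u_i\}$ and $\{v_i\}$ are pseudo-orthonormal bases of the Lie algebra, with $\langle u_1,u_2\rangle=\langle u_3,u_3\rangle=\langle u_4,u_4\rangle=1$ and $\langle v_1,v_1\rangle=\langle v_2,v_2\rangle=\langle v_3,v_4\rangle=1$, respectively. Moreover, the left-invariant metrics in cases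 (2), (3), (4) and (5) are plane waves.
   Context: A left-invariant Lorentzian metric on a Lie group is identified with a Lorentzian inner product $\langle\cdot,\cdot\rangle$ on its Lie algebra (one works at the level of metric Lie algebras). Brackets of basis vectors that are not listed (up to skew-symmetry) are zero, and inner products of basis vectors that are not listed are zero. Two metric Lie algebras (and the corresponding Lie groups with left-invariant metrics) are isomorphically homothetic if there is a Lie algebra isomorphism between them which is a homothety of the inner products, i.e. an isometry up to a positive constant factor. A Lorentzian manifold $(M,g)$ is a pp-wave if it admits a parallel degenerate (null) line field $\mathcal U$ that is locally generated by a parallel null vector field and $(M,g)$ is transversally flat, i.e. its curvature tensor satisfies $R(X,Y)=0$ for all $X,Y\in\mathcal U^\perp$. A pp-wave $(M,g,\mathcal U)$ is a plane wave if moreover $\nabla_XR=0$ for all $X\in\mathcal U^\perp$. *)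

(* Defs.v *)
From HB Require Import structures.
From mathcomp Require Import all_boot all_order all_algebra.
From mathcomp Require Import all_classical all_reals all_analysis.
From mathcomp Require Import ring.

Set Implicit Arguments.
Unset Strict Implicit.
Unset Printing Implicit Defensive.

Import Order.TTheory GRing.Theory Num.Theory.
Import numFieldNormedType.Exports.

Local Open Scope classical_set_scope.
Local Open Scope ring_scope.

Section Smooth.
Context {R : realType} {V W : normedModType R}.

(* [f] is only constrained at the points of [A], and is meant to be used with
   [A] open: [f] is a total function whose values off [A] are irrelevant. *)
Fixpoint Ck_on (k : nat) (A : set V) (f : V -> W) : Prop :=
  if k is k'.+1 then
    (forall y, A y -> differentiable f y) /\
    (forall v : V, Ck_on k' A (fun y => 'D_v f y))
  else forall y, A y -> {for y, continuous f}.

Definition smooth_on (A : set V) (f : V -> W) : Prop := forall k, Ck_on k A f.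

End Smooth.

(* [cmap] is meaningful on [cdom] only, and [cinv] on [cimg] only. *)
Record chart (R : realType) (n : nat) (M : topologicalType) := Chart {
  cdom : set M;
  cmap : M -> 'rV[R]_n;
  cinv : 'rV[R]_n -> M }.

Definition cimg {R : realType} {n : nat} {M : topologicalType}
  (c : chart R n M) : set 'rV[R]_n := cmap c @` cdom c.

Definition is_chart {R : realType} {n : nat} {M : topologicalType}
    (c : chart R n M) : Prop :=
  [/\ open (cdom c), open (cimg c),
      {within cdom c, continuous (cmap c)},
      {within cimg c, continuous (cinv c)} &
      forall p, cdom c p -> cinv c (cmap c p) = p].

#[short(type="groupTopologicalType")]
HB.structure Definition GroupTopological := {G of Group G & Topological G}.

Record lieGroup (R : realType) (n : nat) := LieGroup {
  lg_sort :> groupTopologicalType;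
  lg_atlas : set (chart R n lg_sort);
  lg_hausdorff : hausdorff_space lg_sort;
  lg_second_countable : @second_countable lg_sort;
  lg_charts : forall c, lg_atlas c -> is_chart c;
  lg_cover : forall p, exists2 c, lg_atlas c & cdom c p;
  lg_compatible : forall a b, lg_atlas a -> lg_atlas b ->
    smooth_on (cmap a @` (cdom a `&` cdom b)) (cmap b \o cinv a);
  lg_mul_continuous :
    continuous (fun z : lg_sort * lg_sort => (z.1 * z.2)%g);
  lg_inv_continuous : continuous (fun p : lg_sort => (p^-1)%g);
  lg_mul_smooth : forall a b c, lg_atlas a -> lg_atlas b -> lg_atlas c ->
    smooth_on [set z : 'rV[R]_n * 'rV[R]_n |
                [/\ cimg a z.1, cimg b z.2 &
                    cdom c (cinv a z.1 * cinv b z.2)%g]]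
              (fun z => cmap c (cinv a z.1 * cinv b z.2)%g);
  lg_inv_smooth : forall a b, lg_atlas a -> lg_atlas b ->
    smooth_on [set y | cimg a y /\ cdom b ((cinv a y)^-1)%g]
              (fun y => cmap b ((cinv a y)^-1)%g) }.

Section LieGroup.
Context {R : realType} {n : nat} (G : lieGroup R n).

Definition smooth_in {W : normedModType R} (O : set G) (f : G -> W) : Prop :=
  forall c, lg_atlas c ->
    smooth_on (cmap c @` (cdom c `&` O)) (f \o cinv c).

(* A chart [kappa] at the identity identifies the tangent space T_1 G with
   'rV_n. The left-invariant vector field with value [x] at the identity has at
   [p] the velocity at t = 0 of the curve
   t |-> p * cinv kappa (cmap kappa 1 + t x). *)
Definition lieder {W : normedModType R} (kappa : chart R n G) (x : 'rV[R]_n)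
    (f : G -> W) (p : G) : W :=
  'D_x (fun y => f (p * cinv kappa y)%g) (cmap kappa 1%g).

End LieGroup.

Record lieAlgebra (R : realType) (n : nat) := LieAlgebra {
  bracket :> 'rV[R]_n -> 'rV[R]_n -> 'rV[R]_n;
  bracket_linearl : forall y, linear (bracket^~ y);
  bracket_linearr : forall x, linear (bracket x);
  bracket_alternating : forall x, bracket x x = 0;
  bracket_jacobi : forall x y z,
    bracket x (bracket y z) + bracket y (bracket z x)
      + bracket z (bracket x y) = 0 }.

(* The commutator of the left-invariant fields of [x] and [y] is the
   left-invariant field of [g x y]. *)
Definition lie_algebra_of {R : realType} {n : nat} (G : lieGroup R n)
    (kappa : chart R n G) (g : lieAlgebra R n) : Prop :=
  forall (x y : 'rV[R]_n) (O : set G) (f : G -> R^o) (p : G),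
    open O -> smooth_in O f -> O p ->
    lieder kappa x (lieder kappa y f) p - lieder kappa y (lieder kappa x f) p
      = lieder kappa (g x y) f p.

Definition minkowski (R : realType) (n : nat) : 'M[R]_n :=
  diag_mx (\row_(i < n) (if i == 0%N :> nat then -1 else 1)).

(* Signature (-, +, ..., +); the congruence forces [B] to be symmetric and
   nondegenerate. *)
Definition lorentzian {R : realType} {n : nat} (B : 'M[R]_n) : Prop :=
  exists2 P : 'M[R]_n, P \in unitmx &
    P *m B *m P^T = minkowski R n.

Lemma minkowski_unit (R : realType) (n : nat) : minkowski R n \in unitmx.
Proof.
rewrite unitmxE det_diag unitfE prodf_seq_neq0; apply/allP => i _ /=.
by rewrite mxE; case: ifP => _; rewrite ?oppr_eq0 oner_eq0.
Qed.

Record metricLieAlgebra (R : realType) (n : nat) := MetricLieAlgebra {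
  mla_lie :> lieAlgebra R n;
  gram : 'M[R]_n;
  gram_lorentzian : lorentzian gram }.

Section MetricLieAlgebra.
Context {R : realType} {n : nat} (g : metricLieAlgebra R n).
Implicit Types w x y z : 'rV[R]_n.

Definition ip x y : R := (x *m gram g *m y^T) 0 0.

(* Koszul formula for left-invariant fields: for every k,
   2 <nabla_x y, e_k> = <[x,y], e_k> - <[y,e_k], x> + <[e_k,x], y>. *)
Definition levi_civita x y : 'rV[R]_n :=
  (\row_(k < n)
    (2^-1 * (ip (g x y) (delta_mx 0 k) - ip (g y (delta_mx 0 k)) x
             + ip (g (delta_mx 0 k) x) y))) *m invmx (gram g).

Definition curvature x y z : 'rV[R]_n :=
  levi_civita x (levi_civita y z) - levi_civita y (levi_civita x z)
    - levi_civita (g x y) z.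

Definition nabla_curvature w x y z : 'rV[R]_n :=
  levi_civita w (curvature x y z) - curvature (levi_civita w x) y z
    - curvature x (levi_civita w y) z - curvature x y (levi_civita w z).

Definition flat : Prop := forall x y z, curvature x y z = 0.

Definition orthogonal_to (U : {vspace 'rV[R]_n}) x : Prop :=
  forall u, u \in U -> ip x u = 0.

Lemma gram_sym : (gram g)^T = gram g.
Proof.
have [P uP eP] := gram_lorentzian g.
have /(congr1 trmx) := eP.
rewrite /minkowski tr_diag_mx -/(minkowski R n) -eP !trmx_mul trmxK => e.
apply: (can_inj (mulKmx uP)); apply: (can_inj (mulmxK (_ : P^T \in unitmx))).
  by rewrite unitmx_tr.
by rewrite -mulmxA.
Qed.

Lemma gram_unit : gram g \in unitmx.
Proof.
have [P uP eP] := gram_lorentzian g.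
have := minkowski_unit R n.
by rewrite -eP unitmx_mul unitmx_mul => /andP[/andP[]].
Qed.

Lemma ip_sym x y : ip x y = ip y x.
Proof.
rewrite /ip -[LHS]/((x *m gram g *m y^T) 0 0).
rewrite -[x *m gram g *m y^T]trmxK mxE !trmx_mul trmxK gram_sym.
by rewrite mulmxA.
Qed.

Lemma ip_linearl y : linear (ip^~ y : 'rV[R]_n -> R^o).
Proof. by move=> a u v; rewrite /ip !mulmxDl -!scalemxAl !mxE. Qed.

Lemma koszul x y z :
  2 * ip (levi_civita x y) z
    = ip (g x y) z - ip (g y z) x + ip (g z x) y.
Proof.
pose F (t : 'rV[R]_n) : R^o := ip (g x y) t - ip (g y t) x + ip (g t x) y.
have linF : linear F.
  move=> a u v; rewrite /F bracket_linearr bracket_linearl !(ip_sym (g x y)).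
  by rewrite !ip_linearl /GRing.scale /=; ring.
pose Fl : {linear 'rV[R]_n -> R^o} :=
  HB.pack F (GRing.isLinear.Build _ _ _ _ F linF).
rewrite -[RHS]/(Fl z) {2}[z]row_sum_delta linear_sum /ip /levi_civita mulmxKV.
  rewrite mxE mulr_sumr; apply: eq_bigr => k _.
  by rewrite linearZ !mxE /Fl /= /F /GRing.scale /=; field.
exact: gram_unit.
Qed.

End MetricLieAlgebra.

(* A vector field on the group is represented by its components
   [V : G -> 'rV_n] in the left-invariant frame. *)
Section LineFields.
Context {R : realType} {n : nat} (G : lieGroup R n) (kappa : chart R n G)
        (g : metricLieAlgebra R n).

Definition nabla (x : 'rV[R]_n) (V : G -> 'rV[R]_n) (p : G) : 'rV[R]_n :=
  lieder kappa x V p + levi_civita g x (V p).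

Definition generates (O : set G) (V : G -> 'rV[R]_n)
    (U : G -> {vspace 'rV[R]_n}) : Prop :=
  forall q, O q -> V q != 0 /\ U q = <[V q]>%VS.

Definition line_field (U : G -> {vspace 'rV[R]_n}) : Prop :=
  forall p : G, exists (O : set G) (V : G -> 'rV[R]_n),
    [/\ open O, O p, smooth_in O V & generates O V U].

Definition null_line_field (U : G -> {vspace 'rV[R]_n}) : Prop :=
  forall (p : G) u, u \in U p -> ip g u u = 0.

Definition parallel_line_field (U : G -> {vspace 'rV[R]_n}) : Prop :=
  forall (O : set G) (V : G -> 'rV[R]_n),
    open O -> smooth_in O V -> (forall q, O q -> V q \in U q) ->
    forall q x, O q -> nabla x V q \in U q.

Definition parallel_on (O : set G) (V : G -> 'rV[R]_n) : Prop :=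
  forall q x, O q -> nabla x V q = 0.

Definition null_on (O : set G) (V : G -> 'rV[R]_n) : Prop :=
  forall q, O q -> ip g (V q) (V q) = 0.

Definition pp_wave_along (U : G -> {vspace 'rV[R]_n}) : Prop :=
  [/\ line_field U, null_line_field U, parallel_line_field U,
      forall p : G, exists (O : set G) (V : G -> 'rV[R]_n),
        [/\ open O, O p, smooth_in O V & generates O V U] /\
        parallel_on O V /\ null_on O V &
      forall (p : G) x y z,
        orthogonal_to g (U p) x -> orthogonal_to g (U p) y ->
        curvature g x y z = 0].

Definition pp_wave : Prop := exists U, pp_wave_along U.

Definition plane_wave : Prop :=
  exists U, pp_wave_along U /\
    forall (p : G) w x y z,
      orthogonal_to g (U p) w -> nabla_curvature g w x y z = 0.

End LineFields.

Definition isomorphically_homothetic {R : realType} {n : nat}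
    (g h : metricLieAlgebra R n) : Prop :=
  exists f : {linear 'rV[R]_n -> 'rV[R]_n},
    [/\ bijective f,
        forall x y, f (g x y) = h (f x) (f y) &
        exists2 c : R, 0 < c & forall x y, ip h (f x) (f y) = c * ip g x y].

Section Models.
Context {R : realType}.
Implicit Types (C : nat -> nat -> 'rV[R]_4) (x y z : 'rV[R]_4).

Definition row4 (a b c d : R) : 'rV[R]_4 :=
  \row_(i < 4) nth 0 [:: a; b; c; d] i.

(* [C i j], for 1 <= i < j <= 4, is the row of components of [e_i, e_j]. *)
Definition table_bracket C x y : 'rV[R]_4 :=
  \sum_(i < 4) \sum_(j < 4 | (i < j)%N)
    (x 0 i * y 0 j - x 0 j * y 0 i) *: C i.+1 j.+1.

Definition table_jacobi C : Prop := forall x y z,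
  table_bracket C x (table_bracket C y z)
    + table_bracket C y (table_bracket C z x)
    + table_bracket C z (table_bracket C x y) = 0.

Lemma table_linearl C y : linear ((table_bracket C)^~ y).
Proof.
move=> a u v; rewrite /table_bracket scaler_sumr -big_split; apply: eq_bigr => i _.
rewrite scaler_sumr -big_split; apply: eq_bigr => j _ /=.
by rewrite scalerA -scalerDl !mxE; congr (_ *: _); ring.
Qed.

Lemma table_linearr C x : linear (table_bracket C x).
Proof.
move=> a u v; rewrite /table_bracket scaler_sumr -big_split; apply: eq_bigr => i _.
rewrite scaler_sumr -big_split; apply: eq_bigr => j _ /=.
by rewrite scalerA -scalerDl !mxE; congr (_ *: _); ring.
Qed.

Lemma table_alternating C x : table_bracket C x x = 0.
Proof.
rewrite /table_bracket big1 // => i _; rewrite big1 // => j _.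
by rewrite mulrC subrr scale0r.
Qed.

Definition table_lie C (J : table_jacobi C) : lieAlgebra R 4 :=
  LieAlgebra (table_linearl C) (table_linearr C) (table_alternating C) J.

Definition table1 (g1 g3 : R) (i j : nat) : 'rV[R]_4 :=
  match i, j with
  | 1%N, 4%N => row4 g1 1 (- g3) 0
  | 2%N, 4%N => row4 0 (- g1) 0 0
  | 3%N, 4%N => row4 0 g3 0 0
  | _, _ => 0
  end.

Definition table2 (g2 : R) (i j : nat) : 'rV[R]_4 :=
  match i, j with
  | 2%N, 4%N => row4 0 0 (- (g2 - 1)) 0
  | 3%N, 4%N => row4 (g2 + 1) 0 0 0
  | _, _ => 0
  end.

Definition table3 (g1 g2 g3 g4 g5 g8 : R) (i j : nat) : 'rV[R]_4 :=
  match i, j with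
  | 1%N, 4%N => row4 g1 (- g2) g3 0
  | 2%N, 4%N => row4 g2 g4 g5 0
  | 3%N, 4%N => row4 0 0 g8 0
  | _, _ => 0
  end.

Definition table4 (g1 g2 g3 g4 g5 : R) (i j : nat) : 'rV[R]_4 :=
  match i, j with
  | 1%N, 2%N => row4 0 0 1 0
  | 1%N, 4%N => row4 g1 (- g2) g3 0
  | 2%N, 4%N => row4 g2 g4 g5 0
  | 3%N, 4%N => row4 0 0 (g1 + g4) 0
  | _, _ => 0
  end.

Definition table5 (g1 g2 : R) (i j : nat) : 'rV[R]_4 :=
  match i, j with
  | 1%N, 3%N => row4 0 1 0 0
  | 2%N, 3%N => row4 (- 1) 0 0 0
  | 1%N, 4%N => row4 g1 g2 0 0
  | 2%N, 4%N => row4 (- g2) g1 0 0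
  | _, _ => 0
  end.

Definition o4 (k : nat) : 'I_4 := inord k.

Lemma table_bracketE C x y k :
  let c i j := x 0 (o4 i) * y 0 (o4 j) - x 0 (o4 j) * y 0 (o4 i) in
  table_bracket C x y 0 k =
    c 0 1 * C 1 2 0 k + c 0 2 * C 1 3 0 k + c 0 3 * C 1 4 0 k
    + c 1 2 * C 2 3 0 k + c 1 3 * C 2 4 0 k + c 2 3 * C 3 4 0 k.
Proof.
move=> c; rewrite /table_bracket summxE.
under eq_bigr do rewrite summxE big_mkcond.
pose F (i j : nat) : R := if (i < j)%N then c i j * C i.+1 j.+1 0 k else 0.
rewrite (eq_bigr (fun i : 'I_4 => \sum_(j < 4) F i j)); last first.
  move=> i _; apply: eq_bigr => j _; rewrite /F /c /o4.
  by rewrite !inord_val; case: ifP => // _; rewrite mxE.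
by rewrite !big_ord_recl !big_ord0 /F /=; ring.
Qed.

Lemma row4E a b c d :
  (row4 a b c d 0 (o4 0) = a) * (row4 a b c d 0 (o4 1) = b) *
  (row4 a b c d 0 (o4 2) = c) * (row4 a b c d 0 (o4 3) = d).
Proof. by rewrite /row4 !mxE !inordK. Qed.

Lemma row4P (u v : 'rV[R]_4) :
  u 0 (o4 0) = v 0 (o4 0) -> u 0 (o4 1) = v 0 (o4 1) ->
  u 0 (o4 2) = v 0 (o4 2) -> u 0 (o4 3) = v 0 (o4 3) -> u = v.
Proof.
move=> h0 h1 h2 h3; apply/rowP => k; rewrite -(inord_val k).
by case: k => [[|[|[|[|k]]]] lek].
Qed.

Lemma row0E k : (0 : 'rV[R]_4) 0 k = 0.
Proof. by rewrite mxE. Qed.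

Lemma rowDE x y k : (x + y) 0 k = x 0 k + y 0 k.
Proof. by rewrite mxE. Qed.

Ltac components_tac :=
  rewrite table_bracketE /= !row4E ?row0E; ring.

Ltac jacobi_tac E :=
  let x := fresh "x" in let y := fresh "y" in let z := fresh "z" in
  move=> x y z; apply: row4P; rewrite !rowDE row0E !E; ring.

Lemma table1E (g1 g3 : R) x y :
  let c i j := x 0 (o4 i) * y 0 (o4 j) - x 0 (o4 j) * y 0 (o4 i) in
  let b k := table_bracket (table1 g1 g3) x y 0 (o4 k) in
  (b 0 = g1 * c 0 3) *
  (b 1 = c 0 3 + (- g1) * c 1 3 + g3 * c 2 3) *
  (b 2 = (- g3) * c 0 3) *
  (b 3 = 0).
Proof. by move=> c b; rewrite /b /c; do ?split; components_tac. Qed.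

Lemma table1_jacobi (g1 g3 : R) : table_jacobi (table1 g1 g3).
Proof. jacobi_tac (@table1E g1 g3). Qed.

Lemma table2E (g2 : R) x y :
  let c i j := x 0 (o4 i) * y 0 (o4 j) - x 0 (o4 j) * y 0 (o4 i) in
  let b k := table_bracket (table2 g2) x y 0 (o4 k) in
  (b 0 = (g2 + 1) * c 2 3) *
  (b 1 = 0) *
  (b 2 = (- (g2 - 1)) * c 1 3) *
  (b 3 = 0).
Proof. by move=> c b; rewrite /b /c; do ?split; components_tac. Qed.

Lemma table2_jacobi (g2 : R) : table_jacobi (table2 g2).
Proof. jacobi_tac (@table2E g2). Qed.

Lemma table3E (g1 g2 g3 g4 g5 g8 : R) x y :
  let c i j := x 0 (o4 i) * y 0 (o4 j) - x 0 (o4 j) * y 0 (o4 i) in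
  let b k := table_bracket (table3 g1 g2 g3 g4 g5 g8) x y 0 (o4 k) in
  (b 0 = g1 * c 0 3 + g2 * c 1 3) *
  (b 1 = (- g2) * c 0 3 + g4 * c 1 3) *
  (b 2 = g3 * c 0 3 + g5 * c 1 3 + g8 * c 2 3) *
  (b 3 = 0).
Proof. by move=> c b; rewrite /b /c; do ?split; components_tac. Qed.

Lemma table3_jacobi (g1 g2 g3 g4 g5 g8 : R) : table_jacobi (table3 g1 g2 g3 g4 g5 g8).
Proof. jacobi_tac (@table3E g1 g2 g3 g4 g5 g8). Qed.

Lemma table4E (g1 g2 g3 g4 g5 : R) x y :
  let c i j := x 0 (o4 i) * y 0 (o4 j) - x 0 (o4 j) * y 0 (o4 i) in
  let b k := table_bracket (table4 g1 g2 g3 g4 g5) x y 0 (o4 k) in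
  (b 0 = g1 * c 0 3 + g2 * c 1 3) *
  (b 1 = (- g2) * c 0 3 + g4 * c 1 3) *
  (b 2 = c 0 1 + g3 * c 0 3 + g5 * c 1 3 + (g1 + g4) * c 2 3) *
  (b 3 = 0).
Proof. by move=> c b; rewrite /b /c; do ?split; components_tac. Qed.

Lemma table4_jacobi (g1 g2 g3 g4 g5 : R) : table_jacobi (table4 g1 g2 g3 g4 g5).
Proof. jacobi_tac (@table4E g1 g2 g3 g4 g5). Qed.

Lemma table5E (g1 g2 : R) x y :
  let c i j := x 0 (o4 i) * y 0 (o4 j) - x 0 (o4 j) * y 0 (o4 i) in
  let b k := table_bracket (table5 g1 g2) x y 0 (o4 k) in
  (b 0 = (- 1) * c 1 2 + g1 * c 0 3 + (- g2) * c 1 3) *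
  (b 1 = c 0 2 + g2 * c 0 3 + g1 * c 1 3) *
  (b 2 = 0) *
  (b 3 = 0).
Proof. by move=> c b; rewrite /b /c; do ?split; components_tac. Qed.

Lemma table5_jacobi (g1 g2 : R) : table_jacobi (table5 g1 g2).
Proof. jacobi_tac (@table5E g1 g2). Qed.

(* The nonzero products are <u_1,u_2> = <u_3,u_3> = <u_4,u_4> = 1. *)
Definition gram_u : 'M[R]_4 :=
  \matrix_(i < 4, j < 4)
    ((i.+1, j.+1) \in [:: (1, 2); (2, 1); (3, 3); (4, 4)]%N)%:R.

(* The nonzero products are <v_1,v_1> = <v_2,v_2> = <v_3,v_4> = 1. *)
Definition gram_v : 'M[R]_4 :=
  \matrix_(i < 4, j < 4)
    ((i.+1, j.+1) \in [:: (1, 1); (2, 2); (3, 4); (4, 3)]%N)%:R.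

Lemma gram_u_lorentzian : lorentzian gram_u.
Proof.
pose P : 'M[R]_4 := \matrix_(i < 4, j < 4)
  nth 0 (nth [::] [:: [:: 1; - 2^-1; 0; 0]; [:: 1; 2^-1; 0; 0];
                      [:: 0; 0; 1; 0]; [:: 0; 0; 0; 1]] i) j.
have eP : P *m gram_u *m P^T = minkowski R 4.
  apply/matrixP => i j; rewrite !mxE !big_ord_recl big_ord0 !mxE.
  rewrite !big_ord_recl !big_ord0 !mxE.
  by case: i j => -[|[|[|[|i]]]] // ? [[|[|[|[|j]]]] // ?];
    rewrite /= ?mulr1n ?mulr0n; field.
exists P => //.
have := minkowski_unit R 4.
by rewrite -eP unitmx_mul unitmx_mul => /andP[/andP[]].
Qed.

Lemma gram_v_lorentzian : lorentzian gram_v.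
Proof.
pose P : 'M[R]_4 := \matrix_(i < 4, j < 4)
  nth 0 (nth [::] [:: [:: 0; 0; 1; - 2^-1]; [:: 0; 0; 1; 2^-1];
                      [:: 1; 0; 0; 0]; [:: 0; 1; 0; 0]] i) j.
have eP : P *m gram_v *m P^T = minkowski R 4.
  apply/matrixP => i j; rewrite !mxE !big_ord_recl big_ord0 !mxE.
  rewrite !big_ord_recl !big_ord0 !mxE.
  by case: i j => -[|[|[|[|i]]]] // ? [[|[|[|[|j]]]] // ?];
    rewrite /= ?mulr1n ?mulr0n; field.
exists P => //.
have := minkowski_unit R 4.
by rewrite -eP unitmx_mul unitmx_mul => /andP[/andP[]].
Qed.

Definition model1 (g1 g3 : R) : metricLieAlgebra R 4 :=
  @MetricLieAlgebra R 4 (table_lie (table1_jacobi g1 g3))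
    gram_u gram_u_lorentzian.

Definition model2 (g2 : R) : metricLieAlgebra R 4 :=
  @MetricLieAlgebra R 4 (table_lie (table2_jacobi g2))
    gram_u gram_u_lorentzian.

Definition model3 (g1 g2 g3 g4 g5 g8 : R) : metricLieAlgebra R 4 :=
  @MetricLieAlgebra R 4 (table_lie (table3_jacobi g1 g2 g3 g4 g5 g8))
    gram_v gram_v_lorentzian.

Definition model4 (g1 g2 g3 g4 g5 : R) : metricLieAlgebra R 4 :=
  @MetricLieAlgebra R 4 (table_lie (table4_jacobi g1 g2 g3 g4 g5))
    gram_v gram_v_lorentzian.

Definition model5 (g1 g2 : R) : metricLieAlgebra R 4 :=
  @MetricLieAlgebra R 4 (table_lie (table5_jacobi g1 g2))
    gram_v gram_v_lorentzian.

End Models.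

(* Main.v *)
From HB Require Import structures.
Require Import Defs.
From mathcomp Require Import all_boot all_order all_algebra.
From mathcomp Require Import all_classical all_reals all_analysis.
From mathcomp Require Import ring lra.

(* The right-invariant field of a vector [v] spanning an ideal is a multiple
   [phi *: v] of the left-invariant one, and [phi] is an inverse matrix
   coefficient of the adjoint representation. This integrates the line field of
   [v] to parallel null fields in the plane wave models, where
   [nabla_x v = lambda x *: v] and either [lambda = 0] or
   [[x, v] = lambda x *: v].

   Conversely, a local parallel field of a pp-wave is annihilated by the
   curvature, and in the non-flat case the curvature determines its line. So the
   line field is spanned by a left-invariant [u] with [nabla_x u = a x *: u], where
   [a] vanishes on commutators. In a null frame [(u, e1, e2, m)] the connection
   consists of [a], the rotation form [w] of the screen [e1, e2], and two shear
   forms [b1], [b2]; torsion-freeness expresses the bracket through them, and the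
   pp-wave condition says that [w] also vanishes on commutators and that the shear
   curvature is supported on [e1 /\ m] and [e2 /\ m]. If [a] is nonzero on the
   orthogonal of [u], a null rotation leads to model 1 (or to a flat metric when
   [a u != 0]). Otherwise this orthogonal is an ideal: it is the Euclidean Lie
   algebra if [w u != 0] (model 5), and abelian or a Heisenberg algebra if
   [w u = 0] (models 3 and 4, after diagonalizing the symmetric part of the
   shear). *)

Set Implicit Arguments.
Unset Strict Implicit.
Unset Printing Implicit Defensive.

Import Order.TTheory GRing.Theory Num.Theory.
Import numFieldNormedType.Exports.

Local Open Scope classical_set_scope.
Local Open Scope ring_scope.

(** * Iterated differentiability *)

(** The factor [phi] has to solve [x phi = - lambda x * phi] near a given point. As [lambda] is
    closed, a Poincaré lemma would do; the adjoint representation gives instead a solution that is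
    already integrated, at the price of the symmetry of second derivatives and of a calculus for
    maps into the group.

    Conversely, the parallel field of a pp-wave is neither global nor left-invariant. Once its line
    is constant in the left-invariant frame, all happens at the identity: the conditions become
    quadratic equations in the values of [a], [w], [b1], [b2] at [u], [e1], [e2], [m]. Each case is
    solved by cancelling a nonzero number and by the fact that a sum of real squares vanishes only
    trivially.

    Model 2 is no separate case of the classification: its parallel vector [u_1] has [a = 0] and
    [w u = 0], so that these metrics reappear in models 3 and 4. *)

Section NearEqDifferentiable.
Context {R : realType} {V W : normedModType R}.
Implicit Types (f g : V -> W).

Lemma near_eq_differentiable f g (y : V) :
  (\forall z \near y, f z = g z) -> differentiable f y -> differentiable g y.
Proof.
move=> fg df; have [dfc dfo] := (diff_locallyP y f).1 df.
have fgy : f y = g y by exact: nbhs_singleton fg.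
have E : g \o shift y = cst (g y) + 'd f y +o_ 0 id.
  apply/eqaddoP => e e0; move/eqaddoP : dfo => /(_ e e0).
  rewrite -fgy; apply: filterS2.
    by move=> z; apply.
  have := fg; rewrite (near_shift 0) subr0 => H; near=> z => /=.
  by rewrite -[X in `|X|]/(f (z + y) - _) -[X in _ -> `|X| <= _]/(g (z + y) - _)
    (near H z).
by apply/diff_locallyP; rewrite (diff_unique dfc E).
Unshelve. all: by end_near. Qed.
End NearEqDifferentiable.

Section CkBasics.
Context {R : realType} {V W : normedModType R}.
Implicit Types (A B : set V) (f g : V -> W).

Lemma Ck_on_sub k A B f : A `<=` B -> Ck_on k B f -> Ck_on k A f.
Proof.
elim: k f => [|k IH] f AB /=; first by move=> H y /AB; exact: H.
by move=> [H1 H2]; split=> [y /AB|v]; [exact: H1|exact: IH].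
Qed.

Lemma Ck_on_local k A f :
  (forall y, A y -> exists2 B, B y & Ck_on k B f) -> Ck_on k A f.
Proof.
elim: k f => [|k IH] f H /=.
  by move=> y /H[B By]; exact.
split=> [y /H[B By [+ _]]|v]; first exact.
by apply: IH => y /H[B By [_ /(_ v)]]; exists B.
Qed.

(** Openness matters because every derivative at a point of [A] sees a neighbourhood of it. This is
    the tool for replacing a chart expression by an equal one. *)
Lemma Ck_on_ext k A f g : open A -> (forall y, A y -> f y = g y) ->
  Ck_on k A f -> Ck_on k A g.
Proof.
move=> oA; elim: k f g => [|k IH] f g fg /=.
  move=> H y Ay; have nA : nbhs y A by exact: open_nbhs_nbhs.
  rewrite /prop_for /continuous_at -(fg y Ay).
  apply: cvg_trans (H y Ay); apply: near_eq_cvg.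
  by apply: filterS nA => z /fg.
have nfg y : A y -> \forall z \near y, f z = g z.
  move=> Ay; have nA : nbhs y A by exact: open_nbhs_nbhs.
  by apply: filterS nA => z /fg.
move=> [H1 H2]; split.
  by move=> y Ay; exact: near_eq_differentiable (nfg _ Ay) (H1 _ Ay).
by move=> v; apply: IH (H2 v) => y Ay; exact: near_eq_derive (nfg _ Ay).
Qed.

Lemma Ck_on_le k A f : Ck_on k.+1 A f -> Ck_on k A f.
Proof.
elim: k f => [|k IH] f /= [H1 H2].
  by move=> y Ay; exact: differentiable_continuous (H1 _ Ay).
by split=> // v; apply: IH; exact: H2.
Qed.

Lemma Ck_on_cst k A (w : W) : Ck_on k A (cst w).
Proof.
elim: k w => [|k IH] w /=; first by move=> y _; exact: cst_continuous.
split=> [y _|v]; first exact: differentiable_cst.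
by rewrite (_ : (fun y => _) = cst 0) //; apply/funext => y; rewrite derive_cst.
Qed.

Lemma Ck_on_add k A f g : open A -> Ck_on k A f -> Ck_on k A g ->
  Ck_on k A (fun y => f y + g y).
Proof.
move=> oA; elim: k f g => [|k IH] f g /=.
  by move=> H1 H2 y Ay; apply: continuousD; [exact: H1|exact: H2].
move=> [f1 f2] [g1 g2]; split=> [y Ay|v].
  by apply: differentiableD; [exact: f1|exact: g1].
apply: (Ck_on_ext (f := fun y => 'D_v f y + 'D_v g y)) => //; last exact: IH.
by move=> y Ay; rewrite -deriveD //; apply: diff_derivable; [exact: f1|exact: g1].
Qed.

End CkBasics.

Lemma Ck_on_linear {R : realType} {V W W' : normedModType R} k (A : set V)
  (f : V -> W) (L : {linear W -> W'}) :
  open A -> continuous L -> Ck_on k A f -> Ck_on k A (L \o f).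
Proof.
move=> oA cL; elim: k f => [|k IH] f /=.
  by move=> H y Ay; apply: continuous_comp; [exact: H|exact: cL].
move=> [f1 f2]; split=> [y Ay|v].
  by apply: differentiable_comp; [exact: f1|exact: linear_differentiable].
apply: (Ck_on_ext (f := L \o (fun y => 'D_v f y))) => //; last exact: IH.
move=> y Ay /=; have df := f1 _ Ay; have dL := linear_differentiable (f y) cL.
have dLf : differentiable (L \o f) y by exact: differentiable_comp.
by rewrite !deriveE // (diff_comp df dL) /= (diff_lin (f y) cL).
Qed.

Section CkScalar.
Context {R : realType} {V : normedModType R}.
Implicit Types (A : set V) (f g : V -> R^o).

Lemma Ck_on_mul k A f g : open A -> Ck_on k A f -> Ck_on k A g ->
  Ck_on k A ((fun y => f y * g y) : V -> R^o).
Proof.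
move=> oA; elim: k f g => [|k IH] f g.
  by move=> H1 H2 y Ay; exact: (cvgM (H1 _ Ay) (H2 _ Ay)).
move=> Hf Hg; have [f1 f2] := Hf; have [g1 g2] := Hg; split=> [y Ay|v].
  by exact: (differentiableM (f1 _ Ay) (g1 _ Ay)).
apply: (Ck_on_ext (f := fun y => f y * 'D_v g y + g y * 'D_v f y)) => //.
  by move=> y Ay; rewrite -deriveM //; apply: diff_derivable; [exact: f1|exact: g1].
exact: (Ck_on_add oA (IH _ _ (Ck_on_le Hf) (g2 v)) (IH _ _ (Ck_on_le Hg) (f2 v))).
Qed.

Lemma Ck_on_inv k A f : open A -> (forall y, A y -> f y != 0) -> Ck_on k A f ->
  Ck_on k A ((fun y => (f y)^-1) : V -> R^o).
Proof.
move=> oA f0; elim: k => [|k IH].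
  by move=> H y Ay; exact: (cvgV (f0 _ Ay) (H _ Ay)).
move=> Hf; have [f1 f2] := Hf; split=> [y Ay|v].
  by exact: (differentiableV (f1 _ Ay) (f0 _ Ay)).
have If := IH (Ck_on_le Hf).
(* The derivative of the inverse is written with products only, so that [Ck_on_mul] and the
   induction hypothesis apply. *)
apply: (Ck_on_ext (f := fun y => - 1 * (((f y)^-1 * (f y)^-1) * 'D_v f y) : R^o)) => //.
  move=> y Ay; rewrite deriveV ?f0 //; last exact: diff_derivable (f1 _ Ay).
  by rewrite /GRing.scale /= expr2 invfM mulN1r mulNr.
exact: (Ck_on_mul oA (Ck_on_cst _ _ _) (Ck_on_mul oA (Ck_on_mul oA If If) (f2 v))).
Qed.

End CkScalar.

(** Finite dimension in the form that the chain rule needs: finitely many continuous coordinates,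
    stable under products, so that charts on pairs and triples of points are covered. *)
Definition has_coordinates {R : realType} (V : normedModType R) : Prop :=
  exists (I : finType) (e : I -> V) (l : I -> {linear V -> R^o}),
    (forall i, continuous (l i)) /\ forall v, v = \sum_i l i v *: e i.

Lemma has_coordinates_row (R : realType) n : has_coordinates 'rV[R]_n.
Proof.
pose c (i : 'I_n) (v : 'rV[R]_n) : R^o := v 0 i.
have lc i : linear (c i) by move=> a u v; rewrite /c !mxE.
pose L i : {linear 'rV[R]_n -> R^o} :=
  HB.pack (c i) (GRing.isLinear.Build _ _ _ _ (c i) (lc i)).
exists 'I_n, (fun i => delta_mx 0 i), L.
split=> [i|v]; first exact: coord_continuous.
by rewrite {1}[v]row_sum_delta.
Qed.

Lemma has_coordinates_scalar (R : realType) : has_coordinates R^o.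
Proof.
exists unit, (fun=> 1), (fun=> idfun); split=> [_ v|v]; first exact: cvg_id.
by rewrite (bigD1 tt) //= big1 ?addr0 => [|[]] //; rewrite [_ *: _]mulr1.
Qed.

Lemma has_coordinates_pair (R : realType) (V W : normedModType R) :
  has_coordinates V -> has_coordinates W -> has_coordinates (V * W)%type.
Proof.
move=> [I [e [l [cl el]]]] [J [e' [l' [cl' el']]]].
pose c (k : I + J) (z : V * W) : R^o :=
  match k with inl i => l i z.1 | inr j => l' j z.2 end.
have lc k : linear (c k) by case: k => k a u v /=; rewrite linearP.
pose L k : {linear (V * W)%type -> R^o} :=
  HB.pack (c k) (GRing.isLinear.Build _ _ _ _ (c k) (lc k)).
exists (I + J)%type,
  (fun k => match k with inl i => (e i, 0) | inr j => (0, e' j) end), L.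
split=> [[i|j] z|[v w]] /=.
- by apply: (@cvg_comp _ _ _ fst (l i)); [exact: cvg_fst|exact: cl].
- by apply: (@cvg_comp _ _ _ snd (l' j)); [exact: cvg_snd|exact: cl'].
rewrite [RHS]surjective_pairing.
rewrite (big_morph (fun z : V * W => z.1) (id1 := 0) (op1 := +%R)) //.
rewrite (big_morph (fun z : V * W => z.2) (id1 := 0) (op1 := +%R)) // !big_sumType /=.
congr pair.
  by rewrite [X in _ + X]big1 ?addr0 // => j _; rewrite scaler0.
by rewrite [X in X + _]big1 ?add0r // => j _; rewrite scaler0.
Qed.

Lemma Ck_on_sum {R : realType} {V W : normedModType R} k (A : set V)
    (I : Type) (r : seq I) (f : I -> V -> W) : open A ->
  (forall i, Ck_on k A (f i)) -> Ck_on k A (fun y => \sum_(i <- r) f i y).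
Proof.
move=> oA H; elim: r => [|i r IH].
  apply: (Ck_on_ext (f := cst 0)) (Ck_on_cst _ _ _) => // y _.
  by rewrite big_nil.
apply: (Ck_on_ext (f := fun y => f i y + \sum_(i <- r) f i y)) => //.
  by move=> y _; rewrite big_cons.
exact: Ck_on_add.
Qed.

Lemma Ck_on_coordinates {R : realType} {V W : normedModType R} k (A : set V)
    (f : V -> W) : has_coordinates W -> open A ->
  (forall l : {linear W -> R^o}, continuous l -> Ck_on k A (l \o f)) ->
  Ck_on k A f.
Proof.
move=> [I [e [l [cl el]]]] oA H.
apply: (Ck_on_ext (f := fun y => \sum_i l i (f y) *: e i)) => //.
apply: Ck_on_sum => // i.
pose s (a : R^o) : W := a *: e i.
have ls : linear s by move=> a u v; rewrite /s scalerDl scalerA.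
pose sl : {linear R^o -> W} := HB.pack s (GRing.isLinear.Build _ _ _ _ s ls).
apply: (Ck_on_linear (L := sl)) => //; last exact: H.
by move=> a; exact: scalel_continuous.
Qed.

Lemma Ck_on_scale {R : realType} {V W : normedModType R} k (A : set V)
    (f : V -> R^o) (g : V -> W) : has_coordinates W -> open A ->
  Ck_on k A f -> Ck_on k A g -> Ck_on k A (fun y => f y *: g y).
Proof.
move=> cW oA Hf Hg; apply: Ck_on_coordinates => // l cl.
apply: (Ck_on_ext (f := fun y => f y * l (g y))) => //.
  by move=> y _ /=; rewrite linearZ.
by apply: Ck_on_mul => //; exact: Ck_on_linear.
Qed.

(** The derivative of [f \o g] takes [f] in the direction ['D_v g y], which moves with [y].
    Expanding it in the fixed directions [e i] makes the induction hypothesis applicable to each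
    ['D_(e i) f]. *)
Lemma Ck_on_comp {R : realType} {U V W : normedModType R} k (A : set U)
    (B : set V) (g : U -> V) (f : V -> W) :
  has_coordinates V -> has_coordinates W -> open A ->
  (forall y, A y -> B (g y)) ->
  Ck_on k A g -> Ck_on k B f -> Ck_on k A (f \o g).
Proof.
move=> [I [e [l [cl el]]]] cW oA AB; elim: k f => [|k IH] f Hg.
  move=> Hf y Ay; apply: continuous_comp; first exact: Hg.
  by apply: Hf; exact: AB.
move=> [f1 f2]; have [g1 g2] := Hg; split=> [y Ay|v].
  by apply: differentiable_comp; [exact: g1|apply: f1; exact: AB].
apply: (Ck_on_ext (f := fun y => \sum_i l i ('D_v g y) *: 'D_(e i) f (g y))) => //.
  move=> y Ay; have dg := g1 _ Ay; have df := f1 _ (AB _ Ay).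
  rewrite [RHS]deriveE; last exact: differentiable_comp.
  rewrite (diff_comp dg df) /= -(deriveE v dg) [in RHS](el ('D_v g y)) linear_sum.
  by apply: eq_bigr => i _; rewrite linearZ /= -deriveE.
apply: Ck_on_sum => // i; apply: Ck_on_scale => //.
  by apply: Ck_on_linear => //; exact: g2.
exact: (IH _ (Ck_on_le Hg) (f2 _)).
Qed.

Lemma Ck_on_pair {R : realType} {U V W : normedModType R} k (A : set U)
    (f : U -> V) (g : U -> W) : open A -> Ck_on k A f -> Ck_on k A g ->
  Ck_on k A (fun y => (f y, g y)).
Proof.
move=> oA; elim: k f g => [|k IH] f g.
  by move=> H1 H2 y Ay; apply: cvg_pair; [exact: H1|exact: H2].
move=> [f1 f2] [g1 g2]; split=> [y Ay|v].
  by apply: differentiable_pair; [exact: f1|exact: g1].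
apply: (Ck_on_ext (f := fun y => ('D_v f y, 'D_v g y))) => //;
  last exact: (IH _ _ (f2 v) (g2 v)).
move=> y Ay; have df := f1 _ Ay; have dg := g1 _ Ay.
rewrite [RHS]deriveE; last exact: differentiable_pair.
by rewrite diff_pair // !deriveE.
Qed.

(** * Symmetry of second derivatives *)

Lemma is_derive_line {R : realType} {V : normedModType R} (f : V -> R^o)
    (a u : V) (r : R) : derivable f (a + r *: u) u ->
  is_derive r 1 (fun r => f (a + r *: u)) ('D_u f (a + r *: u)).
Proof.
have E : (fun h : R => h^-1 *: (((fun r : R => f (a + r *: u)) \o shift r) (h *: 1)
     - f (a + r *: u))) =
  (fun h => h^-1 *: ((f \o shift (a + r *: u)) (h *: u) - f (a + r *: u))).
  apply/funext => h /=; congr (_ *: (f _ - _)).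
  by rewrite scalerDl addrCA [_ *: 1]mulr1.
by move=> df; apply: DeriveDef; rewrite /derivable /derive E.
Qed.

(** Two applications of the mean value theorem turn the mixed difference into [h ^+ 2] times the
    mixed derivative at an intermediate point, where continuity compares it with its value at
    [y]. *)
Lemma second_difference {R : realType} {V : normedModType R} (A : set V)
    (f : V -> R^o) (y u w : V) (eps : R) : open A -> A y -> Ck_on 2 A f ->
  0 < eps -> \forall h \near 0^'+,
  `|f (y + h *: u + h *: w) - f (y + h *: u) - (f (y + h *: w) - f y)
    - h ^+ 2 * 'D_w (fun z => 'D_u f z) y| <= eps * h ^+ 2.
Proof.
move=> oA Ay [f1 f2] e0; have [f21 /(_ w) f22] := f2 u.
have [F2 F2E] : exists F2 : V -> R, forall z, 'D_w (fun z => 'D_u f z) z = F2 z.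
  by exists (fun z => 'D_w (fun z => 'D_u f z) z).
have cF2 : F2 z @[z --> y] --> F2 y.
  have -> : F2 = (fun z => 'D_w (fun z => 'D_u f z) z) by apply/funext => z.
  exact: f22.
have nA : nbhs y A by exact: open_nbhs_nbhs.
have nD : \forall z \near y, `|F2 y - F2 z| < eps.
  by move/cvgrPdist_lt : cF2 => /(_ _ e0).
have /nbhs_ballP[r /= r0 Hr] : nbhs y (A `&` [set z | `|F2 y - F2 z| < eps]).
  exact: filterI.
(* For [h < r / m] the parallelogram spanned by [h *: u] and [h *: w] at [y] lies in the ball of
   radius [r]; the summand 1 keeps [m] positive when [u] and [w] vanish. *)
pose m := `|u| + `|w| + 1; have m0 : 0 < m by rewrite ltr_wpDl // addr_ge0.
have near_y s t h : 0 <= s <= h -> 0 <= t <= h -> h < r / m ->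
    (A `&` [set z | `|F2 y - F2 z| < eps]) (y + s *: u + t *: w).
  move=> /andP[s0 sh] /andP[t0 th]; rewrite ltr_pdivlMr // => hr; apply: Hr.
  rewrite -ball_normE /= -addrA opprD addrA subrr add0r normrN.
  apply: le_lt_trans hr; apply: le_trans (ler_normD _ _) _; rewrite !normrZ.
  rewrite !ger0_norm // /m !mulrDr mulr1.
  have h0 : 0 <= h by apply: le_trans sh.
  by rewrite -[leLHS]addr0 !lerD // ler_wpM2r.
near=> h.
have h0 : 0 < h by near: h; exact: nbhs_right_gt.
have hr : h < r / m by near: h; apply: nbhs_right_lt; exact: divr_gt0.
have hh : 0 <= h <= h by rewrite lexx ltW.
have h00 : 0 <= (0 : R) <= h by rewrite lexx ltW.
pose k s : R := f (y + s *: u + h *: w) - f (y + s *: u).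
have dk s : 0 <= s <= h ->
    is_derive s 1 k ('D_u f (y + s *: u + h *: w) - 'D_u f (y + s *: u)).
  move=> hs; apply: is_deriveB.
    have E : (fun s => f (y + s *: u + h *: w)) = (fun s => f ((y + h *: w) + s *: u)).
      by apply/funext => s'; rewrite addrAC.
    rewrite E addrAC; apply: is_derive_line; apply: diff_derivable; apply: f1.
    by rewrite addrAC; have [] := near_y s h h hs hh hr.
  apply: is_derive_line; apply: diff_derivable; apply: f1.
  by have [] := near_y s 0 h hs h00 hr; rewrite scale0r addr0.
have [s hs /= Es] : exists2 s, s \in `[0, h] & k h - k 0 =
    ('D_u f (y + s *: u + h *: w) - 'D_u f (y + s *: u)) * (h - 0).
  apply: (MVT_segment (ltW h0)) => [s|].
    by rewrite in_itv /= => /andP[??]; apply: dk; rewrite !ltW.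
  apply: derivable_within_continuous => s; rewrite in_itv /= => hs.
  by have [] := dk s hs.
move: hs; rewrite in_itv /= => hs.
pose k' t : R := 'D_u f (y + s *: u + t *: w).
have dk' t : 0 <= t <= h ->
    is_derive t 1 k' (F2 (y + s *: u + t *: w)).
  move=> ht; rewrite -F2E; apply: (is_derive_line (f := fun z => 'D_u f z)).
  apply: diff_derivable; apply: f21.
  by have [] := near_y s t h hs ht hr.
have [t ht /= Et] : exists2 t, t \in `[0, h] & k' h - k' 0 =
    F2 (y + s *: u + t *: w) * (h - 0).
  apply: (MVT_segment (ltW h0)) => [t|].
    by rewrite in_itv /= => /andP[??]; apply: dk'; rewrite !ltW.
  apply: derivable_within_continuous => t; rewrite in_itv /= => ht.
  by have [] := dk' t ht.
move: ht; rewrite in_itv /= => ht.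
have [_ /= /ltW Ht] := near_y s t h hs ht hr.
have -> : f (y + h *: u + h *: w) - f (y + h *: u) - (f (y + h *: w) - f y) = k h - k 0.
  by rewrite /k !scale0r !addr0.
move: Et; rewrite /k' scale0r addr0 => Et.
rewrite F2E Es Et subr0 -mulrA -expr2 mulrC -mulrBr normrM ger0_norm ?sqr_ge0 //.
by rewrite mulrC distrC ler_wpM2r ?sqr_ge0.
Unshelve. all: by end_near. Qed.

Lemma close_quotients {R : realFieldType} (a p q e s : R) : 0 < s ->
  `|a - s * p| <= e / 2 * s -> `|a - s * q| <= e / 2 * s -> `|p - q| <= e.
Proof.
move=> s0 h1 h2; rewrite -(ler_pM2r s0) -[X in _ * X <= _](ger0_norm (ltW s0)) -normrM.
have -> : (p - q) * s = (a - s * q) - (a - s * p) by ring.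
apply: le_trans (ler_normB _ _) _.
rewrite [leRHS](_ : _ = e / 2 * s + e / 2 * s); last by field.
exact: lerD.
Qed.

(** The second difference is symmetric in [u] and [w], so both mixed derivatives approximate the
    same quotient. *)
Lemma derive_commute {R : realType} {V : normedModType R} (A : set V)
    (f : V -> R^o) (y u w : V) : open A -> A y -> Ck_on 2 A f ->
  'D_w (fun z => 'D_u f z) y = 'D_u (fun z => 'D_w f z) y.
Proof.
move=> oA Ay Hf; apply/eqP; rewrite -subr_eq0 -normr_le0; apply/ler_addgt0Pl => e e0.
rewrite addr0; have e20 : 0 < e / 2 by rewrite divr_gt0.
have H1 := second_difference u w oA Ay Hf e20.
have H2 := second_difference w u oA Ay Hf e20.
have [h [h0 [h1 h2]]] := filter_ex (filterI (nbhs_right_gt (0 : R)) (filterI H1 H2)).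
have hh : 0 < h ^+ 2 by rewrite exprn_gt0.
have E (a b c d : R) : a - b - (c - d) = a - c - (b - d) by ring.
have Eh : y + h *: w + h *: u = y + h *: u + h *: w by rewrite addrAC.
move: h2; rewrite Eh E => h2.
exact: close_quotients hh h1 h2.
Qed.

(** * Smooth maps into a Lie group *)

Lemma open_setI_preimage {S T : topologicalType} (A : set S) (B : set T)
    (h : S -> T) : open A -> open B ->
  (forall y, A y -> {for y, continuous h}) -> open (A `&` h @^-1` B).
Proof.
move=> oA oB ch; rewrite openE => y [Ay By]; apply: filterI.
  exact: open_nbhs_nbhs.
by apply: ch => //; exact: open_nbhs_nbhs.
Qed.

Section ChartTheory.
Context {R : realType} {n : nat} (G : lieGroup R n).
Implicit Types (c : chart R n G) (p : G) (y : 'rV[R]_n).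

Lemma chart_open_dom c : lg_atlas c -> open (cdom c).
Proof. by move=> /lg_charts[]. Qed.

Lemma chart_open_img c : lg_atlas c -> open (cimg c).
Proof. by move=> /lg_charts[]. Qed.

Lemma chart_map_continuous c p : lg_atlas c -> cdom c p ->
  {for p, continuous (cmap c)}.
Proof.
move=> /lg_charts[oc _ + _ _] cp.
by rewrite continuous_open_subspace // => H; apply: H; rewrite inE.
Qed.

Lemma chart_inv_continuous c y : lg_atlas c -> cimg c y ->
  {for y, continuous (cinv c)}.
Proof.
move=> /lg_charts[_ oc _ + _] cy.
by rewrite continuous_open_subspace // => H; apply: H; rewrite inE.
Qed.

Lemma chart_mapK c p : lg_atlas c -> cdom c p -> cinv c (cmap c p) = p.
Proof. by move=> /lg_charts[_ _ _ _]; apply. Qed.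

Lemma chart_invK c y : lg_atlas c -> cimg c y -> cmap c (cinv c y) = y.
Proof. by move=> ac [p cp <-]; rewrite chart_mapK. Qed.

Lemma lg_mul_cvg {S : topologicalType} (h k : S -> G) (y : S) :
  {for y, continuous h} -> {for y, continuous k} ->
  {for y, continuous (fun z => (h z * k z)%g)}.
Proof.
move=> ch ck.
apply: (@cvg_comp _ _ _ (fun z => (h z, k z)) (fun z : G * G => (z.1 * z.2)%g)
  _ (nbhs (h y, k y)) (nbhs (h y * k y)%g)); first exact: cvg_pair.
exact: (@lg_mul_continuous _ _ G (h y, k y)).
Qed.

Lemma lg_inv_cvg {S : topologicalType} (h : S -> G) (y : S) :
  {for y, continuous h} -> {for y, continuous (fun z => (h z)^-1%g)}.
Proof.
by move=> ch; apply: continuous_comp => //; exact: lg_inv_continuous.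
Qed.

End ChartTheory.

Section GroupSmooth.
Context {R : realType} {n : nat} (G : lieGroup R n) {U : normedModType R}.
Implicit Types (A B : set U) (h k : U -> G).

(** Continuity is a separate clause: it makes [A] intersected with the preimage of a chart domain
    open, without which smoothness there would say little. *)
Definition group_smooth A h : Prop :=
  (forall y, A y -> {for y, continuous h}) /\
  forall c, lg_atlas c -> smooth_on (A `&` h @^-1` cdom c) (cmap c \o h).

Lemma group_smooth_sub A B h : A `<=` B -> group_smooth B h -> group_smooth A h.
Proof.
move=> AB [H1 H2]; split=> [y /AB|c ac m]; first exact: H1.
by apply: Ck_on_sub (H2 c ac m); exact: setSI.
Qed.

Lemma group_smooth_cst A p : group_smooth A (cst p).
Proof.
split=> [y _|c ac m]; first exact: cst_continuous.
exact: (Ck_on_cst m _ (cmap c p)).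
Qed.

(** Locally the product factors through charts around the two factors and around the product, where
    the group axiom [lg_mul_smooth] applies. *)
Lemma group_smooth_mul A h k : open A ->
  group_smooth A h -> group_smooth A k ->
  group_smooth A (fun y => h y * k y)%g.
Proof.
move=> oA [ch sh] [ck sk].
have chk y : A y -> {for y, continuous (fun y => h y * k y)%g}.
  by move=> Ay; apply: lg_mul_cvg; [exact: ch|exact: ck].
split=> // c ac m; apply: Ck_on_local => y [Ay cy].
have [a aa ay] := lg_cover (h y); have [b ab by_] := lg_cover (k y).
pose B := (A `&` h @^-1` cdom a) `&` ((A `&` k @^-1` cdom b) `&`
   (A `&` (fun y => h y * k y)%g @^-1` cdom c)).
have oB : open B.
  by apply: openI; [|apply: openI]; apply: open_setI_preimage => //;
    exact: chart_open_dom.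
exists B => //.
apply: (Ck_on_ext (f := (fun z : 'rV[R]_n * 'rV[R]_n =>
    cmap c (cinv a z.1 * cinv b z.2)%g) \o
    (fun y => (cmap a (h y), cmap b (k y))))) => //.
  by move=> z [[_ az] [[_ bz] _]] /=; rewrite !chart_mapK.
apply: (Ck_on_comp _ _ oB _ _ (lg_mul_smooth aa ab ac m)).
- by apply: has_coordinates_pair; exact: has_coordinates_row.
- exact: has_coordinates_row.
- move=> z [[_ az] [[_ bz] [_ cz]]] /=; split; rewrite ?chart_mapK //.
    by exists (h z).
  by exists (k z).
apply: Ck_on_pair => //.
  by apply: Ck_on_sub (sh a aa m) => z [].
by apply: Ck_on_sub (sk b ab m) => z [_ []].
Qed.

Lemma group_smooth_inv A h : open A ->
  group_smooth A h -> group_smooth A (fun y => (h y)^-1)%g.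
Proof.
move=> oA [ch sh].
have chk y : A y -> {for y, continuous (fun y => (h y)^-1)%g}.
  by move=> Ay; apply: lg_inv_cvg; exact: ch.
split=> // c ac m; apply: Ck_on_local => y [Ay cy].
have [a aa ay] := lg_cover (h y).
pose B := (A `&` h @^-1` cdom a) `&` (A `&` (fun y => (h y)^-1)%g @^-1` cdom c).
have oB : open B.
  by apply: openI; apply: open_setI_preimage => //; exact: chart_open_dom.
exists B => //.
apply: (Ck_on_ext (f := (fun z => cmap c (cinv a z)^-1%g) \o
    (fun y => cmap a (h y)))) => //.
  by move=> z [[_ az] _] /=; rewrite !chart_mapK.
apply: (Ck_on_comp _ _ oB _ _ (lg_inv_smooth aa ac m)).
- exact: has_coordinates_row.
- exact: has_coordinates_row.
- move=> z [[_ az] [_ cz]] /=; split; rewrite ?chart_mapK //.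
  by exists (h z).
by apply: Ck_on_sub (sh a aa m) => z [].
Qed.

Lemma smooth_in_comp {W : normedModType R} A h (O : set G) (f : G -> W) :
  has_coordinates W -> open A -> group_smooth A h -> smooth_in O f ->
  (forall y, A y -> O (h y)) -> smooth_on A (f \o h).
Proof.
move=> cW oA [ch sh] sf AO m; apply: Ck_on_local => y Ay.
have [a aa ay] := lg_cover (h y).
pose B := A `&` h @^-1` cdom a.
have oB : open B by apply: open_setI_preimage => //; exact: chart_open_dom.
exists B => //.
apply: (Ck_on_ext (f := (f \o cinv a) \o (cmap a \o h))) => //.
  by move=> z [_ az] /=; rewrite !chart_mapK.
apply: (Ck_on_comp _ _ oB _ (sh a aa m) (sf a aa m)) => //.
  exact: has_coordinates_row.
by move=> z [Az az]; exists (h z) => //; split=> //; exact: AO.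
Qed.

End GroupSmooth.

Lemma group_smooth_comp {R : realType} {n : nat} (G : lieGroup R n)
    {U V : normedModType R} (A : set U) (B : set V) (g : U -> V) (h : V -> G) :
  has_coordinates V -> open A -> smooth_on A g -> (forall y, A y -> B (g y)) ->
  group_smooth B h -> group_smooth A (h \o g).
Proof.
move=> cV oA sg AB [ch sh].
have cg y : A y -> {for y, continuous g} by exact: (sg 0%N).
have chg y : A y -> {for y, continuous (h \o g)}.
  by move=> Ay; apply: continuous_comp; [exact: cg|apply: ch; exact: AB].
split=> // c ac m.
have oC : open (A `&` (h \o g) @^-1` cdom c).
  by apply: open_setI_preimage => //; exact: chart_open_dom.
apply: (Ck_on_comp (f := cmap c \o h) _ _ oC _ _ (sh c ac m)) => //.
- exact: has_coordinates_row.
- by move=> y [Ay cy]; split => //; exact: AB.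
by apply: Ck_on_sub (sg m) => y [].
Qed.

Section LieDerivative.
Context {R : realType} {n : nat} (G : lieGroup R n).
Implicit Types (p q : G) (O : set G).

Lemma group_smooth_chart_inv (a : chart R n G) :
  lg_atlas a -> group_smooth (cimg a) (cinv a).
Proof.
move=> aa; split=> [y ay|b ab m]; first exact: chart_inv_continuous.
apply: Ck_on_sub (lg_compatible aa ab m) => y [[p ap <-]] /=.
by rewrite chart_mapK // => bp; exists p.
Qed.

Lemma smooth_in_continuous {W : normedModType R} O (f : G -> W) p :
  open O -> smooth_in O f -> O p -> {for p, continuous f}.
Proof.
move=> oO sf Op; have [a aa ap] := lg_cover p.
have cf := sf a aa 0%N.
have : {for p, continuous ((f \o cinv a) \o cmap a)}.
  apply: continuous_comp; first exact: chart_map_continuous.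
  by apply: cf; exists p.
rewrite /prop_for /continuous_at /= chart_mapK //; apply: cvg_trans.
apply: near_eq_cvg; have : nbhs p (cdom a).
  by apply: open_nbhs_nbhs; split=> //; exact: chart_open_dom.
by apply: filterS => q aq /=; rewrite chart_mapK.
Qed.

Context (kappa : chart R n G) (kappa_chart : lg_atlas kappa)
        (kappa_one : cdom kappa 1%g).
Let o := cmap kappa 1%g.

Lemma chart_one_img : cimg kappa o.
Proof. by exists 1%g. Qed.

Lemma chart_one_inv : cinv kappa o = 1%g.
Proof. exact: chart_mapK. Qed.

Definition translated_img p O : set 'rV[R]_n :=
  cimg kappa `&` (fun y => p * cinv kappa y)%g @^-1` O.

Lemma open_translated_img p O : open O -> open (translated_img p O).
Proof.
move=> oO; apply: open_setI_preimage => //; first exact: chart_open_img.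
move=> y ky; apply: lg_mul_cvg; first exact: cst_continuous.
exact: chart_inv_continuous.
Qed.

Lemma translated_img_one p O : O p -> translated_img p O o.
Proof. by move=> Op; split; [exact: chart_one_img|rewrite /= chart_one_inv mulg1]. Qed.

Lemma group_smooth_translate p O : open O ->
  group_smooth (translated_img p O) (fun y => p * cinv kappa y)%g.
Proof.
move=> oO; apply: group_smooth_mul; first exact: open_translated_img.
  exact: group_smooth_cst.
apply: group_smooth_sub (group_smooth_chart_inv kappa_chart).
by move=> y [].
Qed.

Lemma smooth_in_translate {W : normedModType R} p O (f : G -> W) :
  has_coordinates W -> open O -> smooth_in O f ->
  smooth_on (translated_img p O) (fun y => f (p * cinv kappa y)%g).
Proof.
move=> cW oO sf; apply: (smooth_in_comp cW _ _ sf).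
- exact: open_translated_img.
- exact: group_smooth_translate.
- by move=> y [].
Qed.

Lemma differentiable_translate {W : normedModType R} p O (f : G -> W) :
  has_coordinates W -> open O -> smooth_in O f -> O p ->
  differentiable (fun y => f (p * cinv kappa y)%g) o.
Proof.
move=> cW oO sf Op; have [+ _] := smooth_in_translate p cW oO sf 1%N.
by apply; exact: translated_img_one.
Qed.

Lemma near_translate p O : open O -> O p ->
  \forall y \near o, O (p * cinv kappa y)%g.
Proof.
move=> oO Op; have : nbhs o (translated_img p O).
  apply: open_nbhs_nbhs; split; first exact: open_translated_img.
  exact: translated_img_one.
by apply: filterS => y [].
Qed.

Lemma lieder_ext {W : normedModType R} x O (f g : G -> W) p : open O -> O p ->
  (forall q, O q -> f q = g q) -> lieder kappa x f p = lieder kappa x g p.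
Proof.
move=> oO Op fg; apply: near_eq_derive.
by apply: filterS (near_translate oO Op) => y; exact: fg.
Qed.

Lemma lieder_linear {W W' : normedModType R} (L : {linear W -> W'}) x O
    (f : G -> W) p : has_coordinates W -> continuous L ->
  open O -> smooth_in O f -> O p ->
  lieder kappa x (L \o f) p = L (lieder kappa x f p).
Proof.
move=> cW cL oO sf Op; have df := differentiable_translate cW oO sf Op.
set F := (fun y => f (p * cinv kappa y)%g) in df.
have dL := linear_differentiable (F o) cL.
have dLf : differentiable (L \o F) o by exact: differentiable_comp.
rewrite /lieder -/o -/F -[fun y => _]/(L \o F) !deriveE //.
by rewrite (diff_comp df dL) /= (diff_lin (F o) cL).
Qed.

Lemma smooth_in_linear {W W' : normedModType R} (L : {linear W -> W'}) O
    (f : G -> W) : continuous L -> open O -> smooth_in O f ->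
  smooth_in O (L \o f).
Proof.
move=> cL oO sf c ac m; apply: (Ck_on_linear (f := f \o cinv c)) => //.
  have -> : cmap c @` (cdom c `&` O) = cimg c `&` cinv c @^-1` O.
    apply/seteqP; split=> [y [q [cq Oq] <-]|y [[q cq <-]]] /=.
      by split; [exists q|rewrite /= chart_mapK].
    by rewrite chart_mapK // => Oq; exists q.
  apply: open_setI_preimage => //; first exact: chart_open_img.
  by move=> y; exact: chart_inv_continuous.
exact: sf.
Qed.

Lemma lieder_scale_arg {W : normedModType R} (a : R) x O (f : G -> W) p :
  has_coordinates W -> open O -> smooth_in O f -> O p ->
  lieder kappa (a *: x) f p = a *: lieder kappa x f p.
Proof.
move=> cW oO sf Op; have df := differentiable_translate cW oO sf Op.
by rewrite /lieder !deriveE // linearZ.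
Qed.

End LieDerivative.

(** * The adjoint character *)

Section ProductDerivatives.
Context {R : realType} {U V W : normedModType R}.

Lemma Ck_on_id k (A : set U) : Ck_on k A (@idfun U).
Proof.
case: k => [|k]; first by move=> y _; exact: cvg_id.
split=> [y _|v].
  by apply: (@linear_differentiable _ _ _ idfun) => z; exact: cvg_id.
rewrite (_ : (fun y => _) = cst v); first exact: Ck_on_cst.
by apply/funext => y; rewrite derive_id.
Qed.

Lemma derive_pair1 (f : U * V -> W) (y x : U) (z : V) :
  'D_x (fun y => f (y, z)) y = 'D_(x, 0) f (y, z).
Proof.
suff E : (fun h : R => h^-1 *: (((fun y => f (y, z)) \o shift y) (h *: x) - f (y, z)))
  = (fun h => h^-1 *: ((f \o shift (y, z)) (h *: (x, 0)) - f (y, z))).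
  by rewrite /derive E.
apply/funext => h /=; congr (_ *: (f _ - _)).
by rewrite -[h *: (x, 0)]/(h *: x, h *: (0 : V)) scaler0
  -[(_, _) + (y, z)]/(_ + y, _ + z) add0r.
Qed.

Lemma derive_pair2 (f : U * V -> W) (y : U) (x z : V) :
  'D_x (fun z => f (y, z)) z = 'D_(0, x) f (y, z).
Proof.
suff E : (fun h : R => h^-1 *: (((fun z => f (y, z)) \o shift z) (h *: x) - f (y, z)))
  = (fun h => h^-1 *: ((f \o shift (y, z)) (h *: (0, x)) - f (y, z))).
  by rewrite /derive E.
apply/funext => h /=; congr (_ *: (f _ - _)).
by rewrite -[h *: (0, x)]/(h *: (0 : U), h *: x) scaler0
  -[(_, _) + (y, z)]/(_ + y, _ + z) add0r.
Qed.

End ProductDerivatives.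

(** This separates the contributions of two occurrences of the same variable, as in a
    conjugation. *)
Lemma derive_diagonal {R : realType} {U W : normedModType R} (f : U * U -> W)
    (y x : U) : differentiable f (y, y) ->
  'D_x (fun y => f (y, y)) y =
  'D_x (fun z => f (z, y)) y + 'D_x (fun z => f (y, z)) y.
Proof.
move=> df; rewrite derive_pair1 derive_pair2 !(deriveE _ df) -linearD /=.
have dd : differentiable (fun z : U => (z, z)) y by exact: differentiable_pair.
have dfd : differentiable (f \o (fun z => (z, z))) y by exact: differentiable_comp.
rewrite -[fun y => f (y, y)]/(f \o (fun z => (z, z))) deriveE // (diff_comp dd df) /=.
rewrite diff_pair //=; congr ('d f (y, y) _).
rewrite -[(x, 0) + (0, x)]/(x + 0, 0 + x) addr0 add0r.
by rewrite -deriveE // derive_id.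
Qed.

Lemma derive_oppr {R : realType} {U W : normedModType R} (f : U -> W) (y x : U) :
  derivable f y x -> 'D_x f y = - 'D_x (fun z => - f z) y.
Proof. by move=> df; rewrite -[fun z => - f z]/(- f) deriveN // opprK. Qed.

Section AdjointCharacter.
Context {R : realType} {n : nat} (G : lieGroup R n).
Context (kappa : chart R n G) (kappa_chart : lg_atlas kappa)
        (kappa_one : cdom kappa 1%g).
Implicit Types (p q r : G) (O : set G).
Let o := cmap kappa 1%g.
Let o_img : cimg kappa o := chart_one_img kappa_one.
Let o_inv : cinv kappa o = 1%g := chart_one_inv kappa_chart kappa_one.

Lemma group_smooth_comp_fst {U V : normedModType R} (A : set U) (h : U -> G) :
  has_coordinates U -> open A -> group_smooth A h ->
  group_smooth [set z : U * V | A z.1] (fun z => h z.1).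
Proof.
move=> cU oA sh.
have oA' : open [set z : U * V | A z.1].
  by apply: (open_comp (f := fst)) => // z _; exact: cvg_fst.
apply: (group_smooth_comp (g := fst) (h := h) cU oA' _ _ sh) => // m.
exact: (Ck_on_linear (L := fst) (f := idfun) oA' (fun z => cvg_fst) (Ck_on_id _ _)).
Qed.

Lemma group_smooth_comp_snd {U V : normedModType R} (A : set V) (h : V -> G) :
  has_coordinates V -> open A -> group_smooth A h ->
  group_smooth [set z : U * V | A z.2] (fun z => h z.2).
Proof.
move=> cU oA sh.
have oA' : open [set z : U * V | A z.2].
  by apply: (open_comp (f := snd)) => // z _; exact: cvg_snd.
apply: (group_smooth_comp (g := snd) (h := h) cU oA' _ _ sh) => // m.
exact: (Ck_on_linear (L := snd) (f := idfun) oA' (fun z => cvg_snd) (Ck_on_id _ _)).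
Qed.

Lemma group_smooth_restrict {W : normedModType R} {U : normedModType R}
    (A : set U) (h : U -> G) O (f : G -> W) :
  has_coordinates W -> open A -> group_smooth A h -> open O -> smooth_in O f ->
  open (A `&` h @^-1` O) /\ smooth_on (A `&` h @^-1` O) (f \o h).
Proof.
move=> cW oA sh oO sf.
have oB : open (A `&` h @^-1` O) by apply: open_setI_preimage => //; case: sh.
split=> //; apply: (smooth_in_comp cW oB _ sf) => [|y []//].
by apply: group_smooth_sub sh => y [].
Qed.

Lemma smooth_in_pull {W : normedModType R} (O : set G) (f : G -> W) (t : G -> G) :
  has_coordinates W -> open O -> smooth_in O f -> continuous t ->
  (forall c, lg_atlas c -> group_smooth (cimg c) (t \o cinv c)) ->
  smooth_in (t @^-1` O) (f \o t).
Proof.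
move=> cW oO sf ct st c ac m.
have [_ sft] := group_smooth_restrict cW (chart_open_img ac) (st c ac) oO sf.
apply: Ck_on_sub (sft m) => y [q [cq Oq] <-]; split; first by exists q.
by rewrite /preimage /= chart_mapK.
Qed.

Let square : set ('rV[R]_n * 'rV[R]_n) :=
  [set z | cimg kappa z.1] `&` [set z | cimg kappa z.2].

Let open_square : open square.
Proof.
have oc := chart_open_img kappa_chart.
apply: openI.
  by apply: (open_comp (f := fst)) => // z _; exact: cvg_fst.
by apply: (open_comp (f := snd)) => // z _; exact: cvg_snd.
Qed.

Let quotient r (z : 'rV[R]_n * 'rV[R]_n) :=
  (r * cinv kappa z.1 * (cinv kappa z.2)^-1)%g.

Let group_smooth_quotient r : group_smooth square (quotient r).
Proof.
have oc := chart_open_img kappa_chart; have cr := has_coordinates_row R n.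
have sk := group_smooth_chart_inv kappa_chart.
apply: group_smooth_mul => //; first apply: group_smooth_mul => //.
- exact: group_smooth_cst.
- by apply: group_smooth_sub (group_smooth_comp_fst cr oc sk) => z [].
apply: group_smooth_inv => //.
by apply: group_smooth_sub (group_smooth_comp_snd cr oc sk) => z [].
Qed.

(** The map [quotient r] is constant on the diagonal, so its two partial derivatives there are
    opposite. *)
Lemma lieder_inv x O (f : G -> R^o) r : open O -> smooth_in O f -> O r ->
  'D_x (fun y => f (r * (cinv kappa y)^-1)%g) o = - lieder kappa x f r.
Proof.
move=> oO sf Or; pose h := quotient r.
have cR := has_coordinates_scalar R.
have [oB sB] := group_smooth_restrict cR open_square (group_smooth_quotient r) oO sf.
have oo : (square `&` h @^-1` O) (o, o).
  by split=> //; rewrite /h /preimage /quotient /= o_inv invg1 !mulg1.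
have [dfh _] := sB 1%N; have := derive_diagonal x (dfh _ oo).
rewrite (_ : (fun y => (f \o h) (y, y)) = cst (f r)); last first.
  by apply/funext => y; rewrite /h /quotient /= mulgK.
rewrite derive_cst => /esym/eqP; rewrite addrC addr_eq0 => /eqP.
rewrite (_ : (fun z => (f \o h) (o, z)) =
  (fun y => f (r * (cinv kappa y)^-1)%g)); last first.
  by apply/funext => y; rewrite /h /quotient /= o_inv mulg1.
move=> ->; congr (- _); rewrite /lieder -/o; congr ('D_x _ o).
by apply/funext => y; rewrite /h /quotient /= o_inv invg1 mulg1.
Qed.

(** This is the differential of [F] at the identity applied to Ad(q) v. If [v] spans an ideal, it
    is, near the identity, a multiple of the character by which Ad acts on the line of [v]. *)
Definition adjoint_character (v : 'rV[R]_n) (F : G -> R^o) (q : G) : R^o :=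
  'D_v (fun y => F (q * cinv kappa y * q^-1)%g) o.

(** The conjugation is jointly smooth in the base point and the differentiated variable; the
    derivative in [v] costs one order, hence [m.+1], and is then restricted to the slice at [o]. *)
Lemma smooth_in_adjoint_character v O (F : G -> R^o) :
  open O -> smooth_in O F -> O 1%g ->
  smooth_in setT (adjoint_character v F).
Proof.
move=> oO sF O1 c ac m.
pose h (z : 'rV[R]_n * 'rV[R]_n) :=
  (cinv c z.1 * cinv kappa z.2 * (cinv c z.1)^-1)%g.
pose A := [set z : 'rV[R]_n * 'rV[R]_n | cimg c z.1] `&` [set z | cimg kappa z.2].
have oc := chart_open_img ac; have ok := chart_open_img kappa_chart.
have oA : open A.
  apply: openI.
    by apply: (open_comp (f := fst)) => // z _; exact: cvg_fst.
  by apply: (open_comp (f := snd)) => // z _; exact: cvg_snd.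
have cr := has_coordinates_row R n.
have sc := group_smooth_chart_inv ac.
have sk := group_smooth_chart_inv kappa_chart.
have sc1 : group_smooth A (fun z => cinv c z.1).
  by apply: group_smooth_sub (group_smooth_comp_fst cr oc sc) => z [].
have sh : group_smooth A h.
  apply: group_smooth_mul => //; first apply: group_smooth_mul => //.
    by apply: group_smooth_sub (group_smooth_comp_snd cr ok sk) => z [].
  exact: group_smooth_inv.
have cR := has_coordinates_scalar R.
have [oB sB] := group_smooth_restrict cR oA sh oO sF.
have -> : cmap c @` (cdom c `&` setT) = cimg c by rewrite setIT.
have -> : adjoint_character v F \o cinv c =
    (fun z => 'D_(0, v) (F \o h) z) \o (fun z => (z, o)).
  by apply/funext => z /=; rewrite -derive_pair2.
apply: (Ck_on_comp _ _ oc _ _ ((sB m.+1).2 (0, v))) => //.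
- exact: has_coordinates_pair.
- move=> z cz; split; first by split.
  by rewrite /preimage /h /= o_inv mulg1 mulgV.
- exact: Ck_on_pair (Ck_on_id _ _) (Ck_on_cst _ _ _).
Qed.

(** Differentiating the two occurrences of [q] in the conjugation gives [x (v f)] and [- v (x f)]
    for a right translate [f] of [F]. Their sum is the derivative along [g x v], which is
    [lambda *: v]. *)
Lemma lieder_adjoint_character (g : lieAlgebra R n) x v (lambda : R) O
    (F : G -> R^o) q :
  lie_algebra_of kappa g -> open O -> smooth_in O F -> O 1%g ->
  g x v = lambda *: v ->
  lieder kappa x (adjoint_character v F) q = lambda * adjoint_character v F q.
Proof.
move=> gG oO sF O1 xv.
(* The fixed right factor [q^-1] of the conjugation is absorbed into [f], so that only
   left-invariant derivatives at [q] remain. *)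
pose t r := (r * q^-1)%g; pose f := F \o t; pose Of := t @^-1` O.
have ct : continuous t.
  move=> r; apply: (lg_mul_cvg (h := idfun) (k := cst q^-1%g));
    [exact: cvg_id|exact: cst_continuous].
have oOf : open Of by apply: open_comp => // r _; exact: ct.
have cR := has_coordinates_scalar R; have cr := has_coordinates_row R n.
have crr := has_coordinates_pair cr cr.
have sf : smooth_in Of f.
  apply: smooth_in_pull => // c ac; apply: group_smooth_mul.
  - exact: chart_open_img.
  - exact: group_smooth_chart_inv.
  - exact: group_smooth_cst.
have Ofq : Of q by rewrite /Of /preimage /= /t mulgV.
have ok := chart_open_img kappa_chart.
have sk := group_smooth_chart_inv kappa_chart.
have cfst (U V : normedModType R) : continuous (fst : U * V -> U).
  by move=> ?; exact: cvg_fst.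
have csnd (U V : normedModType R) : continuous (snd : U * V -> V).
  by move=> ?; exact: cvg_snd.
(* [y.1.1] and [y.1.2] are the two occurrences of the base point in the
   conjugation, [y.2] is the differentiated variable. *)
pose h (y : ('rV[R]_n * 'rV[R]_n) * 'rV[R]_n) :=
  (q * cinv kappa y.1.1 * cinv kappa y.2 * (cinv kappa y.1.2)^-1)%g.
pose A := [set y : ('rV[R]_n * 'rV[R]_n) * 'rV[R]_n | square y.1] `&`
  [set y | cimg kappa y.2].
have oA : open A.
  apply: openI.
    by apply: (open_comp (f := fst) _ open_square) => z _; exact: cfst.
  by apply: (open_comp (f := snd) _ ok) => z _; exact: csnd.
have s11 : group_smooth A (fun y => cinv kappa y.1.1).
  have := @group_smooth_comp_fst _ 'rV[R]_n square _ crr open_square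
    (group_smooth_sub (@subIsetl _ _ _)
      (@group_smooth_comp_fst _ 'rV[R]_n _ _ cr ok sk)).
  by apply: group_smooth_sub => y [].
have s12 : group_smooth A (fun y => cinv kappa y.1.2).
  have := @group_smooth_comp_fst _ 'rV[R]_n square _ crr open_square
    (group_smooth_sub (@subIsetr _ _ _)
      (@group_smooth_comp_snd 'rV[R]_n _ _ _ cr ok sk)).
  by apply: group_smooth_sub => y [].
have s2 : group_smooth A (fun y => cinv kappa y.2).
  by apply: group_smooth_sub (group_smooth_comp_snd cr ok sk) => y [].
have sh : group_smooth A h.
  apply: group_smooth_mul => //; last exact: group_smooth_inv.
  apply: group_smooth_mul => //; apply: group_smooth_mul => //.
  exact: group_smooth_cst.
have [oB sB] := group_smooth_restrict cR oA sh oOf sf.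
set B := _ `&` _ in oB sB; set M := f \o h in sB.
have Bo : B ((o, o), o).
  by split; [split|rewrite /preimage /h /= o_inv invg1 !mulg1].
pose P (z : 'rV[R]_n * 'rV[R]_n) := 'D_v (fun y => M (z, y)) o.
have PE z : P z = 'D_(0, v) M (z, o) by exact: derive_pair2.
have dP : differentiable P (o, o).
  have -> : P = (fun y => 'D_(0, v) M y) \o (fun z => (z, o)).
    by apply/funext => z; exact: PE.
  apply: differentiable_comp.
    apply: differentiable_pair; last exact: differentiable_cst.
    exact: ((Ck_on_id 1 setT).1 _ I).
  exact: (((sB 2%N).2 (0, v)).1 _ Bo).
have fE r : F r = f (r * q)%g by rewrite /f /= /t mulgK.
have diagE : lieder kappa x (adjoint_character v F) q = 'D_x (fun y => P (y, y)) o.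
  rewrite /lieder -/o; congr ('D_x _ o); apply/funext => y.
  rewrite /adjoint_character /P; congr ('D_v _ o); apply/funext => z.
  by rewrite fE /M /h /= invgM !mulgA mulgVK.
rewrite diagE (derive_diagonal x dP).
have -> : 'D_x (fun y => P (y, o)) o = lieder kappa x (lieder kappa v f) q.
  rewrite /lieder -/o; congr ('D_x _ o); apply/funext => y.
  rewrite /P; congr ('D_v _ o); apply/funext => z.
  by rewrite /M /h /= o_inv invg1 mulg1.
(* The variable of [x] occurs inverted and inside the derivative along [v]. After exchanging the two
   derivatives, [lieder_inv] computes the inner one at each nearby point. *)
have -> : 'D_x (fun y => P (o, y)) o = - lieder kappa v (lieder kappa x f) q.
  have [oC sC] := group_smooth_restrict cR open_square (group_smooth_quotient q) oOf sf.
  have Co : (square `&` quotient q @^-1` Of) (o, o).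
    by split; [split|rewrite /preimage /quotient /= o_inv invg1 !mulg1].
  pose N := f \o quotient q.
  have -> : (fun y => P (o, y)) = (fun y => 'D_(v, 0) N (o, y)).
    apply/funext => y; rewrite -derive_pair1 /P; congr ('D_v _ o); apply/funext => z.
    by rewrite /M /N /h /quotient /= o_inv mulg1.
  rewrite (derive_pair2 (fun z => 'D_(v, 0) N z)).
  rewrite (derive_commute _ _ oC Co (sC 2%N)) -derive_pair1.
  pose D y := 'D_(0, x) N (y, o).
  have dD : derivable D o v.
    apply: diff_derivable.
    apply: (differentiable_comp (f := fun y => (y, o)) (g := fun z => 'D_(0, x) N z)).
      apply: differentiable_pair; last exact: differentiable_cst.
      exact: ((Ck_on_id 1 setT).1 _ I).
    exact: (((sC 2%N).2 (0, x)).1 _ Co).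
  rewrite -/(D) (derive_oppr dD); congr (- _).
  apply: near_eq_derive.
  have := near_translate kappa_chart kappa_one oOf Ofq.
  apply: filterS => y Oy; rewrite /= -[RHS]opprK -(lieder_inv x oOf sf Oy).
  by rewrite /D -derive_pair2.
rewrite (gG x v Of f q oOf sf Ofq) xv.
exact: (lieder_scale_arg kappa_chart kappa_one _ _ cR oOf sf Ofq).
Qed.

End AdjointCharacter.

Lemma row_neq0_coordinate {R : nmodType} {n : nat} (v : 'rV[R]_n) :
  v != 0 -> exists i, v 0 i != 0.
Proof.
move=> v0; apply/existsP; apply: contraNT v0.
rewrite negb_exists => /forallP v0; apply/eqP/rowP => i; rewrite mxE.
by apply/eqP; have := v0 i; rewrite negbK.
Qed.

(* The adjoint character of [v] has logarithmic derivative [lambda x] along [x],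
   so its inverse is the factor sought; translating by [p] makes it nonzero at
   [p]. *)
Lemma integrating_factor {R : realType} {n : nat} (G : lieGroup R n)
    (kappa : chart R n G) (g : lieAlgebra R n) (v : 'rV[R]_n)
    (lambda : 'rV[R]_n -> R) (p : G) :
  lg_atlas kappa -> cdom kappa 1%g -> lie_algebra_of kappa g ->
  v != 0 -> (forall x, g x v = lambda x *: v) ->
  exists (O : set G) (phi : G -> R^o),
    [/\ open O, O p, smooth_in O phi, (forall q, O q -> phi q != 0) &
      forall q x, O q -> lieder kappa x phi q = - lambda x * phi q].
Proof.
move=> ak k1 gG v0 gv.
have [i vi] := row_neq0_coordinate v0.
pose ci (x : 'rV[R]_n) : R^o := x 0 i.
have lci : linear ci by move=> a x y; rewrite /ci !mxE.
pose L : {linear 'rV[R]_n -> R^o} := HB.pack ci (GRing.isLinear.Build _ _ _ _ ci lci).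
have cL : continuous L by exact: coord_continuous.
have cR := has_coordinates_scalar R; have cr := has_coordinates_row R n.
have okd := chart_open_dom ak.
have skappa : smooth_in (cdom kappa) (cmap kappa).
  move=> c ac m; exact: (lg_compatible ac ak m).
pose t (r : G) := (p^-1 * r * p)%g.
have ct : continuous t.
  move=> r; apply: (lg_mul_cvg (h := fun r => (p^-1 * r)%g) (k := cst p));
    last exact: cst_continuous.
  by apply: (lg_mul_cvg (h := cst p^-1%g) (k := idfun));
    [exact: cst_continuous|exact: cvg_id].
have sF0 : smooth_in (t @^-1` cdom kappa) (cmap kappa \o t).
  apply: smooth_in_pull => // c ac.
  have oc := chart_open_img ac.
  apply: group_smooth_mul => //; last exact: group_smooth_cst.
  apply: group_smooth_mul => //; first exact: group_smooth_cst.
  exact: group_smooth_chart_inv.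
pose O := t @^-1` cdom kappa.
have oO : open O by apply: open_comp => // r _; exact: ct.
pose F : G -> R^o := L \o (cmap kappa \o t).
have sF : smooth_in O F by exact: smooth_in_linear.
have O1 : O 1%g by rewrite /O /preimage /= /t mulg1 mulVg.
pose psi := adjoint_character kappa v F.
have spsi : smooth_in setT psi by exact: smooth_in_adjoint_character oO sF O1.
have cpsi : continuous psi.
  by move=> q; apply: (smooth_in_continuous openT spsi).
(* By the choice of [t], the function differentiated at [p] is, near the base point, just the
   coordinate [i] of the chart variable. *)
have psip : psi p = v 0 i.
  rewrite /psi /adjoint_character (_ : 'D_v _ _ = 'D_v L (cmap kappa 1%g)).
    by rewrite deriveE ?diff_lin //; exact: linear_differentiable.
  apply: near_eq_derive.
  have : nbhs (cmap kappa 1%g) (cimg kappa).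
    by apply: open_nbhs_nbhs; split; [exact: chart_open_img|exists 1%g].
  apply: filterS => y ky; rewrite /F /= /t.
  by rewrite !mulgA mulgVK mulVg mul1g chart_invK.
exists [set q | psi q != 0], (fun q => (psi q)^-1); split => //=.
- rewrite -[[set _ | _]]/(psi @^-1` [set r : R | r != 0]).
  by apply: open_comp => [r _|]; [exact: cpsi|exact: open_neq].
- by rewrite psip.
- move=> c ac m.
  have -> : (fun q => (psi q)^-1) \o cinv c = (fun y => ((psi \o cinv c) y)^-1).
    by [].
  have -> : cmap c @` (cdom c `&` [set q | psi q != 0]) =
      cimg c `&` cinv c @^-1` [set q | psi q != 0].
    apply/seteqP; split=> [y [q [cq Oq] <-]|y [[q cq <-]]] /=.
      by split; [exists q|rewrite /preimage /= chart_mapK].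
    by rewrite /preimage /= chart_mapK // => Oq; exists q.
  have oc := chart_open_img ac.
  apply: Ck_on_inv => //.
  + apply: open_setI_preimage => //; last by move=> y; exact: chart_inv_continuous.
    rewrite -[[set _ | _]]/(psi @^-1` [set r : R | r != 0]).
    by apply: open_comp => [r _|]; [exact: cpsi|exact: open_neq].
  + by move=> y [].
  by apply: Ck_on_sub (spsi c ac m) => y [[q cq <-] _]; exists q.
- by move=> q psiq; rewrite invr_eq0.
move=> q x psiq.
have dpsi := differentiable_translate ak k1 cR openT spsi (I : setT q).
rewrite /lieder deriveV /=.
- rewrite -/(lieder kappa x psi q) (lieder_adjoint_character ak k1 q gG oO sF O1 (gv x)).
  rewrite (chart_mapK ak k1) mulg1 -/psi /GRing.scale /=.
  by field.
- by rewrite chart_mapK // mulg1.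
exact: diff_derivable dpsi.
Qed.

(** * Metric Lie algebras *)

(* [ring] compares its atoms up to conversion, which is slow on unabstracted
   inner products. *)
Ltac ip_abstract :=
  repeat match goal with |- context [ip ?g ?x ?y] => generalize (ip g x y); intro end.
Ltac ip_ring := ip_abstract; ring.

Lemma sum_sqr_eq0 {R : realDomainType} (x y : R) :
  x ^+ 2 + y ^+ 2 = 0 -> x = 0 /\ y = 0.
Proof.
move/eqP; rewrite paddr_eq0 ?sqr_ge0 // !sqrf_eq0.
by move=> /andP[/eqP -> /eqP ->].
Qed.

(** The classical combination of the Bianchi identities for the four cyclic shifts of the arguments,
    all permuted values being atoms of a linear problem. *)
Lemma pair_symmetry {R : realFieldType} {T : Type} (r : T -> T -> T -> T -> R) :
  (forall x y z w, r y x z w = - r x y z w) ->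
  (forall x y z w, r x y z w = - r x y w z) ->
  (forall x y z w, r x y z w + r y z x w + r z x y w = 0) ->
  forall x y z w, r x y z w = r z w x y.
Proof.
move=> S M B x y z w.
have := B x y z w; have := B y z w x; have := B z w x y; have := B w x y z;
have := S x y z w; have := M x y z w; have := S x y w z; have := S x z y w;
have := M x z y w; have := S x z w y; have := S x w y z; have := M x w y z;
have := S x w z y; have := M y x z w; have := S y z x w; have := M y z x w;
have := S y z w x; have := S y w x z; have := M y w x z; have := S y w z x;
have := M z x y w; have := M z y x w; have := S z w x y; have := M z w x y;
have := S z w y x; have := M w x y z; have := M w y x z; have := M w z x y; lra.
Qed.

Section MetricLieAlgebraTheory.
Context {R : realType} {n : nat} (g : metricLieAlgebra R n).
Implicit Types (w x y z : 'rV[R]_n).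
Local Notation "<| x , y |>" := (ip g x y) (at level 0, format "<| x ,  y |>").
Local Notation nab := (levi_civita g).
Local Notation Rm := (curvature g).

Lemma ipE x y : <|x, y|> = (x *m gram g *m y^T) 0 0.
Proof. by []. Qed.

Lemma ipDl x y z : <|x + y, z|> = <|x, z|> + <|y, z|>.
Proof. by rewrite /ip !mulmxDl mxE. Qed.

Lemma ipZl (a : R) x z : <|a *: x, z|> = a * <|x, z|>.
Proof. by rewrite /ip -!scalemxAl mxE. Qed.

Lemma ipNl x z : <|- x, z|> = - <|x, z|>.
Proof. by rewrite -scaleN1r ipZl mulN1r. Qed.

Lemma ip0l z : <|0, z|> = 0.
Proof. by rewrite -(scale0r 0) ipZl mul0r. Qed.

Lemma ipBl x y z : <|x - y, z|> = <|x, z|> - <|y, z|>.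
Proof. by rewrite ipDl ipNl. Qed.

Lemma ipDr x y z : <|z, x + y|> = <|z, x|> + <|z, y|>.
Proof. by rewrite ip_sym ipDl !(ip_sym g z). Qed.

Lemma ipZr (a : R) x z : <|z, a *: x|> = a * <|z, x|>.
Proof. by rewrite ip_sym ipZl (ip_sym g z). Qed.

Lemma ipNr x z : <|z, - x|> = - <|z, x|>.
Proof. by rewrite ip_sym ipNl (ip_sym g z). Qed.

Lemma ip0r z : <|z, 0|> = 0.
Proof. by rewrite ip_sym ip0l. Qed.

Lemma ipBr x y z : <|z, x - y|> = <|z, x|> - <|z, y|>.
Proof. by rewrite ipDr ipNr. Qed.

Definition ip_lin := (ipDl, ipDr, ipNl, ipNr, ipZl, ipZr, ip0l, ip0r).

Lemma ip_nondeg x : (forall z, <|x, z|> = 0) -> x = 0.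
Proof.
move=> H; apply: (can_inj (mulmxK (gram_unit g))); rewrite mul0mx.
apply/rowP => k; have := H (delta_mx 0 k).
by rewrite /ip mxE (bigD1 k) //= big1 ?addr0 => [|j jk];
  rewrite !mxE ?eqxx /= ?mulr1 // (negPf jk) mulr0.
Qed.

Lemma ip_inj x y : (forall z, <|x, z|> = <|y, z|>) -> x = y.
Proof.
move=> H; apply/eqP; rewrite -subr_eq0; apply/eqP; apply: ip_nondeg => z.
by rewrite ipBl H subrr.
Qed.

Local Opaque ip levi_civita.

Lemma brDl x y z : g (x + y) z = g x z + g y z.
Proof. by have := bracket_linearl g z 1 x y; rewrite !scale1r. Qed.

Lemma brDr x y z : g z (x + y) = g z x + g z y.
Proof. by have := bracket_linearr g z 1 x y; rewrite !scale1r. Qed.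

Lemma br0l z : g 0 z = 0.
Proof. by apply: (addrI (g 0 z)); rewrite -brDl !addr0. Qed.

Lemma br0r z : g z 0 = 0.
Proof. by apply: (addrI (g z 0)); rewrite -brDr !addr0. Qed.

Lemma brZl (a : R) x z : g (a *: x) z = a *: g x z.
Proof. by have := bracket_linearl g z a x 0; rewrite br0l !addr0. Qed.

Lemma brZr (a : R) x z : g z (a *: x) = a *: g z x.
Proof. by have := bracket_linearr g z a x 0; rewrite br0r !addr0. Qed.

Lemma brNl x z : g (- x) z = - g x z.
Proof. by rewrite -scaleN1r brZl scaleN1r. Qed.

Lemma brNr x z : g z (- x) = - g z x.
Proof. by rewrite -scaleN1r brZr scaleN1r. Qed.

Definition br_lin := (brDl, brDr, brNl, brNr, brZl, brZr, br0l, br0r).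

Lemma br_skew x y : g y x = - g x y.
Proof.
have := bracket_alternating g (x + y).
rewrite !br_lin !bracket_alternating add0r addr0 => /eqP.
by rewrite addr_eq0 => /eqP ->; rewrite opprK.
Qed.

(** Every explicit connection below is verified through this form of the Koszul formula, which
    avoids inverting the Gram matrix. *)
Lemma levi_civita_unique x y c :
  (forall z, 2 * <|c, z|> = <|g x y, z|> - <|g y z, x|> + <|g z x, y|>) ->
  nab x y = c.
Proof.
move=> H; apply: ip_inj => z; apply: (@mulfI _ 2); first by rewrite pnatr_eq0.
by rewrite koszul H.
Qed.

Lemma nabDl x y z : nab (x + y) z = nab x z + nab y z.
Proof.
apply: levi_civita_unique => w; rewrite ipDl mulrDr !koszul !br_lin !ip_lin; ip_ring.
Qed.

Lemma nabDr x y z : nab z (x + y) = nab z x + nab z y.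
Proof.
apply: levi_civita_unique => w; rewrite ipDl mulrDr !koszul !br_lin !ip_lin; ip_ring.
Qed.

Lemma nabZl (a : R) x z : nab (a *: x) z = a *: nab x z.
Proof.
apply: levi_civita_unique => w.
by rewrite ipZl mulrCA !koszul !br_lin !ip_lin; ip_ring.
Qed.

Lemma nabZr (a : R) x z : nab z (a *: x) = a *: nab z x.
Proof.
apply: levi_civita_unique => w.
by rewrite ipZl mulrCA !koszul !br_lin !ip_lin; ip_ring.
Qed.

Lemma nab0l z : nab 0 z = 0.
Proof. by rewrite -[X in nab X z](scale0r 0) nabZl scale0r. Qed.

Lemma nab0r z : nab z 0 = 0.
Proof. by rewrite -[X in nab z X](scale0r 0) nabZr scale0r. Qed.

Lemma nabNl x z : nab (- x) z = - nab x z.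
Proof. by rewrite -scaleN1r nabZl scaleN1r. Qed.

Lemma nabNr x z : nab z (- x) = - nab z x.
Proof. by rewrite -scaleN1r nabZr scaleN1r. Qed.

Definition nab_lin := (nabDl, nabDr, nabNl, nabNr, nabZl, nabZr, nab0l, nab0r).

Lemma nab_metric x y z : <|nab x y, z|> = - <|y, nab x z|>.
Proof.
apply: (@mulfI _ 2); first by rewrite pnatr_eq0.
rewrite koszul mulrN (ip_sym g y) koszul (br_skew y z) (br_skew x y) (br_skew z x) !ip_lin; ip_ring.
Qed.

Lemma nab_torsion x y : g x y = nab x y - nab y x.
Proof.
apply: ip_inj => z; apply: (@mulfI _ 2); first by rewrite pnatr_eq0.
rewrite ipBl mulrBr !koszul (br_skew x y) (br_skew y z) (br_skew z x) !ip_lin; ip_ring.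
Qed.

Lemma curvature_skew x y z : Rm y x z = - Rm x y z.
Proof.
apply: ip_inj => w; rewrite /curvature (br_skew x y) !nab_lin !ip_lin; ip_ring.
Qed.

Lemma curvatureDr x y z w : Rm x y (z + w) = Rm x y z + Rm x y w.
Proof. apply: ip_inj => t; rewrite /curvature !nab_lin !ip_lin; ip_ring. Qed.

Lemma curvatureZr (a : R) x y z : Rm x y (a *: z) = a *: Rm x y z.
Proof. apply: ip_inj => t; rewrite /curvature !nab_lin !ip_lin; ip_ring. Qed.

Lemma curvatureDl x y z w : Rm (x + y) z w = Rm x z w + Rm y z w.
Proof. apply: ip_inj => t; rewrite /curvature brDl !nab_lin !ip_lin; ip_ring. Qed.

Lemma curvatureZl (a : R) x y z : Rm (a *: x) y z = a *: Rm x y z.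
Proof. apply: ip_inj => t; rewrite /curvature brZl !nab_lin !ip_lin; ip_ring. Qed.

Lemma curvature_metric x y z w : <|Rm x y z, w|> = - <|Rm x y w, z|>.
Proof.
rewrite /curvature !ip_lin.
rewrite (nab_metric x (nab y z)) (nab_metric y (nab x z)) (nab_metric (g x y) z).
rewrite (nab_metric x (nab y w)) (nab_metric y (nab x w)) (nab_metric (g x y) w).
rewrite (ip_sym g (nab y z)) (ip_sym g (nab x z)) -(nab_metric (g x y) z).
by rewrite (ip_sym g _ w) -(nab_metric (g x y) w); ip_ring.
Qed.

(** This is the Jacobi identity with outer brackets expanded by torsion-freeness; the inner bracket
    is kept where it is the direction of differentiation, as in the last term of the curvature. *)
Lemma bianchi x y z : Rm x y z + Rm y z x + Rm z x y = 0.
Proof.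
have E a b c : g a (g b c) = nab a (nab b c) - nab a (nab c b) - nab (g b c) a.
  by rewrite (nab_torsion a (g b c)) {1}(nab_torsion b c) nabDr nabNr.
have := bracket_jacobi g x y z; rewrite (E x y z).
rewrite (E y z x).
rewrite (E z x y).
rewrite /curvature.
move: (nab x (nab y z)) (nab x (nab z y)) (nab (g y z) x) (nab y (nab z x))
  (nab y (nab x z)) (nab (g z x) y) (nab z (nab x y)) (nab z (nab y x))
  (nab (g x y) z) => a b c d e f h i j H.
apply/rowP => k; move/rowP/(_ k): H; rewrite !mxE; lra.
Qed.

Lemma curvature_pair x y z w : <|Rm x y z, w|> = <|Rm z w x, y|>.
Proof.
apply: (pair_symmetry (r := fun x y z w => <|Rm x y z, w|>)) => a b c d.
- by rewrite curvature_skew ipNl.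
- exact: curvature_metric.
by rewrite -!ipDl bianchi ip0l.
Qed.

End MetricLieAlgebraTheory.

(** * Null frames *)

Local Opaque ip levi_civita.

Section Frames.
Context {R : realType}.
Implicit Types (x y z u v : 'rV[R]_4).

Definition rows4 (x0 x1 x2 x3 : 'rV[R]_4) : 'M[R]_4 :=
  \matrix_(i < 4) nth 0 [:: x0; x1; x2; x3] i.

Lemma row_rows4 x0 x1 x2 x3 i :
  row i (rows4 x0 x1 x2 x3) = nth 0 [:: x0; x1; x2; x3] i.
Proof. by rewrite rowK. Qed.

Lemma mul_rows4 (r : 'rV[R]_4) x0 x1 x2 x3 : r *m rows4 x0 x1 x2 x3 =
  r 0 (o4 0) *: x0 + r 0 (o4 1) *: x1 + r 0 (o4 2) *: x2 + r 0 (o4 3) *: x3.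
Proof.
rewrite mulmx_sum_row.
rewrite (eq_bigr (fun i : 'I_4 => r 0 (o4 i) *: nth 0 [:: x0; x1; x2; x3] i)).
  by rewrite !big_ord_recl big_ord0 /= addr0 !addrA.
by move=> i _; rewrite row_rows4 /o4 inord_val.
Qed.

Lemma row4_mul_rows4 a b c d x0 x1 x2 x3 :
  row4 a b c d *m rows4 x0 x1 x2 x3 = a *: x0 + b *: x1 + c *: x2 + d *: x3.
Proof. by rewrite mul_rows4 !row4E. Qed.

Variable g : metricLieAlgebra R 4.
Local Notation "<| x , y |>" := (ip g x y) (at level 0, format "<| x ,  y |>").

Lemma gram_rows (F : 'M[R]_4) i j :
  (F *m gram g *m F^T) i j = <|row i F, row j F|>.
Proof.
rewrite ipE -row_mul mxE [RHS]mxE; apply: eq_bigr => k _.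
by rewrite !mxE.
Qed.

Definition null_frame u e1 e2 m : Prop :=
  [/\ <|u, u|> = 0, <|u, m|> = 1, <|m, m|> = 0, <|e1, e1|> = 1 & <|e2, e2|> = 1]
  /\ [/\ <|e1, e2|> = 0, <|u, e1|> = 0, <|u, e2|> = 0, <|m, e1|> = 0
       & <|m, e2|> = 0].

Lemma null_frameE u e1 e2 m : null_frame u e1 e2 m ->
  (<|u, u|> = 0) * (<|u, m|> = 1) * (<|m, m|> = 0) * (<|e1, e1|> = 1) *
  (<|e2, e2|> = 1) * (<|e1, e2|> = 0) * (<|u, e1|> = 0) * (<|u, e2|> = 0) *
  (<|m, e1|> = 0) * (<|m, e2|> = 0) * (<|m, u|> = 1) * (<|e2, e1|> = 0) *
  (<|e1, u|> = 0) * (<|e2, u|> = 0) * (<|e1, m|> = 0) * (<|e2, m|> = 0).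
Proof.
move=> [[h1 h2 h3 h4 h5] [h6 h7 h8 h9 h10]]; do !split=> //.
all: by rewrite ip_sym.
Qed.

Lemma null_frame_gram u e1 e2 m : null_frame u e1 e2 m ->
  rows4 e1 e2 u m *m gram g *m (rows4 e1 e2 u m)^T = gram_v.
Proof.
move=> /null_frameE F; apply/matrixP => i j; rewrite gram_rows !row_rows4 mxE.
by case: i j => -[|[|[|[|i]]]] // ? [[|[|[|[|j]]]] // ?]; rewrite /= F.
Qed.

(** The parallel line is that of [u_2] in model 1 and that of [v_3] in models 3 to 5, which dictates
    the two orders of the frame. *)
Lemma null_frame_gram_u u e1 e2 m : null_frame u e1 e2 m ->
  rows4 m u e1 e2 *m gram g *m (rows4 m u e1 e2)^T = gram_u.
Proof.
move=> /null_frameE F; apply/matrixP => i j; rewrite gram_rows !row_rows4 mxE.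
by case: i j => -[|[|[|[|i]]]] // ? [[|[|[|[|j]]]] // ?]; rewrite /= F.
Qed.

Lemma lorentzian_unit (B : 'M[R]_4) : lorentzian B -> B \in unitmx.
Proof.
move=> [P uP eP]; have := minkowski_unit R 4.
by rewrite -eP unitmx_mul unitmx_mul => /andP[/andP[]].
Qed.

Lemma frame_unit (B F : 'M[R]_4) : lorentzian B ->
  F *m gram g *m F^T = B -> F \in unitmx.
Proof.
move=> /lorentzian_unit; move=> + FB; rewrite -FB.
by rewrite unitmx_mul unitmx_mul => /andP[/andP[]].
Qed.

Lemma null_frame_decomp u e1 e2 m x : null_frame u e1 e2 m ->
  x = <|x, m|> *: u + <|x, e1|> *: e1 + <|x, e2|> *: e2 + <|x, u|> *: m.
Proof.
move=> F; have uF := frame_unit gram_v_lorentzian (null_frame_gram F).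
have := mulmxKV uF x; rewrite mul_rows4.
move: (x *m _) => r; move/null_frameE: F => F <-.
rewrite !ip_lin !F !(mulr0, mulr1, addr0, add0r).
by apply/rowP => k; rewrite !mxE; ring.
Qed.

Lemma bracket_skew_sum (E : 'I_4 -> 'I_4 -> 'rV[R]_4) (r s : 'rV[R]_4) :
  (forall i, E i i = 0) -> (forall i j, E j i = - E i j) ->
  \sum_(i < 4) \sum_(j < 4) (r 0 i * s 0 j) *: E i j =
  \sum_(i < 4) \sum_(j < 4 | (i < j)%N)
    (r 0 i * s 0 j - r 0 j * s 0 i) *: E i j.
Proof.
move=> E0 ES; apply/rowP => k; rewrite !summxE.
pose e (i j : nat) : R := E (o4 i) (o4 j) 0 k.
rewrite (eq_bigr (fun i : 'I_4 => \sum_(j < 4) r 0 (o4 i) * s 0 (o4 j) * e i j)); last first.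
  by move=> i _; rewrite summxE; apply: eq_bigr => j _; rewrite mxE /e /o4 !inord_val.
rewrite [RHS](eq_bigr (fun i : 'I_4 => \sum_(j < 4)
   if (i < j)%N then (r 0 (o4 i) * s 0 (o4 j) - r 0 (o4 j) * s 0 (o4 i)) * e i j else 0)); last first.
  move=> i _; rewrite summxE big_mkcond; apply: eq_bigr => j _.
  by case: ifP => // _; rewrite mxE /e /o4 !inord_val.
have e0 i : e i i = 0 by rewrite /e E0 mxE.
have es i j : e j i = - e i j by rewrite /e ES mxE.
rewrite !big_ord_recl !big_ord0 /= !e0 (es 0 1)%N (es 0 2)%N (es 0 3)%N
  (es 1 2)%N (es 1 3)%N (es 2 3)%N.
ring.
Qed.

(** Taking components in the frame is the isomorphism. The scale factor is 1: constants are
    normalised by boosts of the null pair rather than by rescaling the metric. *)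
Lemma homothetic_of_frame (B F : 'M[R]_4) (LB : lorentzian B) C
    (J : table_jacobi C) : F *m gram g *m F^T = B ->
  (forall i j : 'I_4, (i < j)%N -> g (row i F) (row j F) = C i.+1 j.+1 *m F) ->
  isomorphically_homothetic g (@MetricLieAlgebra R 4 (table_lie J) B LB).
Proof.
move=> FB FC; have uF := frame_unit LB FB.
have key (r s : 'rV[R]_4) : g (r *m F) (s *m F) = table_bracket C r s *m F.
  rewrite (mulmx_sum_row r) (mulmx_sum_row s).
  have -> : g (\sum_i r 0 i *: row i F) (\sum_j s 0 j *: row j F) =
      \sum_i \sum_j (r 0 i * s 0 j) *: g (row i F) (row j F).
    rewrite (big_morph (fun x => g x _) (fun x y => brDl g x y _) (br0l g _)).
    apply: eq_bigr => i _; rewrite brZl.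
    rewrite (big_morph (fun x => g _ x) (fun x y => brDr g x y _) (br0r g _)) scaler_sumr.
    by apply: eq_bigr => j _; rewrite brZr scalerA.
  rewrite (bracket_skew_sum (E := fun i j => g (row i F) (row j F))).
  - rewrite /table_bracket mulmx_suml; apply: eq_bigr => i _.
    rewrite mulmx_suml; apply: eq_bigr => j ij.
    by rewrite -scalemxAl FC.
  - by move=> i; exact: bracket_alternating.
  - by move=> i j; exact: br_skew.
exists (mulmxr (invmx F)); split.
- exists (mulmxr F) => x /=; first exact: mulmxKV.
  exact: mulmxK.
- move=> x y /=; apply: (can_inj (mulmxK uF)); rewrite mulmxKV // -key.
  by rewrite !mulmxKV.
exists 1 => // x y; rewrite mul1r.
rewrite !ipE /= -FB !trmx_mul !mulmxA mulmxKV //.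
have E : F^T *m (invmx F)^T = 1%:M by rewrite -trmx_mul mulVmx // trmx1.
by rewrite -(mulmxA (x *m gram g)) E mulmx1.
Qed.

End Frames.

Section FrameChanges.
Context {R : realType} (g : metricLieAlgebra R 4).
Implicit Types (x y z u v m e : 'rV[R]_4).
Local Notation "<| x , y |>" := (ip g x y) (at level 0, format "<| x ,  y |>").

(** These isometries fix [u] and act trivially on its orthogonal modulo [u]; the last coefficient is
    what keeps the new [m] null. *)
Lemma null_rotation u e1 e2 m (c1 c2 : R) : null_frame g u e1 e2 m ->
  null_frame g u (e1 + c1 *: u) (e2 + c2 *: u)
    (m - c1 *: e1 - c2 *: e2 - ((c1 ^+ 2 + c2 ^+ 2) / 2) *: u).
Proof.
by move=> /null_frameE F; split; split; rewrite ?ip_lin ?F; field.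
Qed.

Lemma screen_rotation u e1 e2 m (c s : R) : c ^+ 2 + s ^+ 2 = 1 ->
  null_frame g u e1 e2 m ->
  null_frame g u (c *: e1 + s *: e2) (- s *: e1 + c *: e2) m.
Proof.
move=> cs /null_frameE F; split; split; rewrite ?ip_lin ?F; try ring.
  by rewrite -[RHS]cs; ring.
by rewrite -[RHS]cs; ring.
Qed.

Lemma null_boost u e1 e2 m (s : R) : s != 0 ->
  null_frame g u e1 e2 m -> null_frame g (s *: u) e1 e2 (s^-1 *: m).
Proof.
by move=> s0 /null_frameE F; split; split; rewrite ?ip_lin ?F; field.
Qed.

(* [m] is the reflection of [u] in the time axis and [e1], [e2] are the images
   of two coordinate axes under a Householder reflection of the third onto the
   spatial part of [u]. *)
Lemma null_frame_exists u : u != 0 -> <|u, u|> = 0 ->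
  exists e1 e2 m, null_frame g u e1 e2 m.
Proof.
have [P uP eP] := gram_lorentzian g.
have ipP (r s : 'rV[R]_4) : <|r *m P, s *m P|> =
    - r 0 (o4 0) * s 0 (o4 0) + r 0 (o4 1) * s 0 (o4 1)
    + r 0 (o4 2) * s 0 (o4 2) + r 0 (o4 3) * s 0 (o4 3).
  have -> : <|r *m P, s *m P|> = (r *m Defs.minkowski R 4 *m s^T) 0 0.
    by rewrite ipE -eP trmx_mul !mulmxA.
  rewrite /Defs.minkowski mul_mx_diag mxE.
  rewrite (eq_bigr (fun i : 'I_4 => (if i == 0%N :> nat then -1 else 1) *
    (r 0 (o4 i) * s 0 (o4 i)))); last first.
    by move=> i _; rewrite !mxE /o4 inord_val; ring.
  by rewrite !big_ord_recl big_ord0 /=; ring.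
rewrite -{2 3}(mulmxKV uP u) => u0; rewrite ipP.
have [a [b [c [d ra]]]] : exists a b c d, u *m invmx P = row4 a b c d.
  exists ((u *m invmx P) 0 (o4 0)), ((u *m invmx P) 0 (o4 1)),
    ((u *m invmx P) 0 (o4 2)), ((u *m invmx P) 0 (o4 3)).
  by apply: row4P; rewrite !row4E.
rewrite ra !row4E => q.
have uE : u = row4 a b c d *m P by rewrite -ra mulmxKV.
have a0 : a != 0.
  apply: contraNneq u0 => a0; rewrite uE.
  move: q; rewrite a0 => q.
  have b2 := sqr_ge0 b; have c2 := sqr_ge0 c; have d2 := sqr_ge0 d.
  have /eqP : b ^+ 2 = 0 by lra.
  have /eqP : c ^+ 2 = 0 by lra.
  have /eqP : d ^+ 2 = 0 by lra.
  rewrite !sqrf_eq0 => /eqP -> /eqP -> /eqP ->.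
  rewrite (_ : row4 0 0 0 0 = 0) ?mul0mx //.
  by apply: row4P; rewrite !row4E mxE.
(* Since [u] is null, its spatial part has length [r] up to sign. The sign is chosen so that the
   Householder denominator [r - b] does not vanish. *)
have [r [ar rb]] : exists r, (a = r \/ a = - r) /\ r != b.
  have [ab|ab] := eqVneq a b; last by exists a; split; [left|].
  exists (- a); split; first by right; rewrite opprK.
  by rewrite -ab; apply: contraNneq a0 => h; apply/eqP; lra.
have r0 : r != 0 by case: ar a0 => ->; rewrite ?oppr_eq0.
have rb0 : r - b != 0 by rewrite subr_eq0.
have Q : b ^+ 2 + c ^+ 2 + d ^+ 2 - r ^+ 2 = 0.
  by rewrite -[RHS]q; case: ar => ->; ring.
exists (row4 0 (c / r) (1 - c ^+ 2 / (r * (r - b))) (- c * d / (r * (r - b))) *m P).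
exists (row4 0 (d / r) (- c * d / (r * (r - b))) (1 - d ^+ 2 / (r * (r - b))) *m P).
exists (row4 (- a / (2 * r ^+ 2)) (b / (2 * r ^+ 2)) (c / (2 * r ^+ 2)) (d / (2 * r ^+ 2)) *m P).
(* Each frame relation holds modulo the null condition [Q]; the argument [k] is its cofactor. *)
have byQ (k s t : R) : s - t = k * (b ^+ 2 + c ^+ 2 + d ^+ 2 - r ^+ 2) -> s = t.
  by rewrite Q mulr0 => /eqP; rewrite subr_eq0 => /eqP.
have n0 : r != 0 /\ r - b != 0 by [].
rewrite uE; split; split; rewrite ipP !row4E.
- exact: q.
- by apply: (byQ (2 * r ^+ 2)^-1); case: ar => ->; field; rewrite ?rb0 ?r0.
- by apply: (byQ (4 * r ^+ 4)^-1); case: ar => ->; field; rewrite ?rb0 ?r0.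
- by apply: (byQ (c ^+ 2 / (r * (r - b)) ^+ 2)); field; rewrite ?rb0 ?r0.
- by apply: (byQ (d ^+ 2 / (r * (r - b)) ^+ 2)); field; rewrite ?rb0 ?r0.
- by apply: (byQ (c * d / (r * (r - b)) ^+ 2)); field; rewrite ?rb0 ?r0.
- by apply: (byQ (- c / (r * (r - b)))); field; rewrite ?rb0 ?r0.
- by apply: (byQ (- d / (r * (r - b)))); field; rewrite ?rb0 ?r0.
- by apply: (byQ (- c / (2 * r ^+ 3 * (r - b)))); field; rewrite ?rb0 ?r0.
- by apply: (byQ (- d / (2 * r ^+ 3 * (r - b)))); field; rewrite ?rb0 ?r0.
Qed.

(** Any frame at [u] is moved by a null rotation onto the given [m]: its screen components determine
    the rotation, and nullity then fixes its component along [u]. *)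
Lemma null_frame_pair u m : <|u, u|> = 0 -> <|m, m|> = 0 -> <|u, m|> = 1 ->
  exists e1 e2, null_frame g u e1 e2 m.
Proof.
move=> uu mm um.
have u0 : u != 0.
  by apply: contra_eq_neq um => ->; rewrite ip0l eq_sym oner_eq0.
have [e1 [e2 [m' F]]] := null_frame_exists u0 uu.
have mE := null_frame_decomp m F; have := null_frame_decomp m F.
move: mm; rewrite (ip_sym g m u) um; rewrite [in <|m, m|>]mE.
set p := <|m, m'|>; set q := <|m, e1|>; set r := <|m, e2|>.
rewrite (ip_sym g m u) um; have FE := null_frameE F; rewrite !ip_lin !FE => mm mE'.
exists (e1 + (- q) *: u), (e2 + (- r) *: u).
have := null_rotation (- q) (- r) F.
suff -> : m' - - q *: e1 - - r *: e2 - (((- q) ^+ 2 + (- r) ^+ 2) / 2) *: u = m by [].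
rewrite mE' scale1r; have -> : p = - ((q ^+ 2 + r ^+ 2) / 2) by lra.
by apply/rowP => k; rewrite !mxE; ring.
Qed.

(** The metric is positive definite on the orthogonal of [u] modulo [u]. *)
Lemma null_orthogonal u v : u != 0 -> <|u, u|> = 0 -> <|v, v|> = 0 ->
  <|u, v|> = 0 -> exists k, v = k *: u.
Proof.
move=> u0 uu vv uv; have [e1 [e2 [m F]]] := null_frame_exists u0 uu.
have vE := null_frame_decomp v F; move: vv; rewrite [in <|v, v|>]vE.
have FE := null_frameE F; rewrite (ip_sym g v u) uv !ip_lin !FE => vv.
exists <|v, m|>; rewrite [LHS]vE (ip_sym g v u) uv scale0r addr0.
have h1 := sqr_ge0 <|v, e1|>; have h2 := sqr_ge0 <|v, e2|>.
have /eqP : <|v, e1|> ^+ 2 = 0 by lra.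
have /eqP : <|v, e2|> ^+ 2 = 0 by lra.
by rewrite !sqrf_eq0 => /eqP -> /eqP ->; rewrite !scale0r !addr0.
Qed.

End FrameChanges.

(** * Structure equations *)

(* The algebraic content of the pp-wave condition along the line of [u], where
   the connection form of the line field is [a]. *)
Definition pp_vector {R : realType} (g : metricLieAlgebra R 4) (u : 'rV[R]_4)
    (a : 'rV[R]_4 -> R) : Prop :=
  [/\ u != 0, ip g u u = 0, (forall x, levi_civita g x u = a x *: u),
      (forall x y, curvature g x y u = 0) &
      forall x y z, ip g x u = 0 -> ip g y u = 0 -> curvature g x y z = 0].

Section StructureEquations.
Context {R : realType} (g : metricLieAlgebra R 4).
Context (u e1 e2 m : 'rV[R]_4) (a : 'rV[R]_4 -> R).
Hypothesis F : null_frame g u e1 e2 m.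
Hypothesis PP : pp_vector g u a.
Implicit Types (x y z v : 'rV[R]_4).
Local Notation "<| x , y |>" := (ip g x y) (at level 0, format "<| x ,  y |>").
Local Notation nab := (levi_civita g).
Local Notation Rm := (curvature g).

Let FE := null_frameE F.

Definition screen_form x : R := <|nab x e1, e2|>.
(** The sign makes [b1] and [b2] the screen components of [nab x m]. *)
Definition shear_form e x : R := - <|nab x e, m|>.

Local Notation w := screen_form.
Local Notation b1 := (shear_form e1).
Local Notation b2 := (shear_form e2).

Let u0 : u != 0. Proof. by case: PP. Qed.

Lemma nab_u x : nab x u = a x *: u. Proof. by case: PP. Qed.

Lemma line_formE x : a x = <|nab x u, m|>.
Proof. by rewrite nab_u ipZl FE mulr1. Qed.

Lemma line_form_linear (c : R) x y : a (c *: x + y) = c * a x + a y.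
Proof. by rewrite !line_formE nabDl nabZl !ip_lin. Qed.

Lemma screen_form_linear (c : R) x y : w (c *: x + y) = c * w x + w y.
Proof. by rewrite /screen_form nabDl nabZl !ip_lin. Qed.

Lemma shear_form_linear e (c : R) x y :
  shear_form e (c *: x + y) = c * shear_form e x + shear_form e y.
Proof. by rewrite /shear_form nabDl nabZl !ip_lin opprD mulrN. Qed.

Lemma nab_self x v : <|nab x v, v|> = 0.
Proof. by have := nab_metric g x v v; rewrite (ip_sym g v); lra. Qed.

Lemma nab_e1 x : nab x e1 = w x *: e2 - b1 x *: u.
Proof.
rewrite {1}(null_frame_decomp (nab x e1) F) nab_self scale0r addr0.
rewrite (nab_metric g x e1 u) nab_u ipZr FE mulr0 oppr0 scale0r addr0.
by rewrite /shear_form scaleNr opprK addrC.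
Qed.

Lemma nab_e2 x : nab x e2 = - w x *: e1 - b2 x *: u.
Proof.
rewrite {1}(null_frame_decomp (nab x e2) F) nab_self scale0r addr0.
rewrite (nab_metric g x e2 u) nab_u ipZr FE mulr0 oppr0 scale0r addr0.
rewrite (nab_metric g x e2 e1) (ip_sym g e2) -/(w x).
by rewrite /shear_form [(- <|_, m|>) *: u]scaleNr opprK addrC.
Qed.

Lemma nab_m x : nab x m = b1 x *: e1 + b2 x *: e2 - a x *: m.
Proof.
rewrite {1}(null_frame_decomp (nab x m) F) nab_self scale0r add0r.
rewrite (nab_metric g x m u) nab_u ipZr FE mulr1 scaleNr.
by rewrite (nab_metric g x m e1) (nab_metric g x m e2) !(ip_sym g m).
Qed.

Lemma form_linE (l : 'rV[R]_4 -> R) :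
  (forall c x y, l (c *: x + y) = c * l x + l y) ->
  (forall x y, l (x + y) = l x + l y) * (forall x, l (- x) = - l x) *
  (forall c x, l (c *: x) = c * l x) * (l 0 = 0).
Proof.
move=> H; have l0 : l 0 = 0 by have := H (-1) 0 0; rewrite scaler0 addr0; lra.
split; [split; [split|]|] => // [x y|x|c x].
- by have := H 1 x y; rewrite scale1r mul1r.
- by have := H (-1) x 0; rewrite scaleN1r l0 !addr0 mulN1r.
by have := H c x 0; rewrite l0 !addr0.
Qed.

(** The connection on a line is commutative, so its curvature is minus [a] of the bracket, and the
    curvature kills [u]. *)
Lemma line_form_closed x y : a (g x y) = 0.
Proof.
have [_ _ _ /(_ x y) + _] := PP; rewrite /curvature !nab_u !nabZr !nab_u.
move/(congr1 (ip g ^~ m)); rewrite !ip_lin !FE; lra.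
Qed.

Lemma curvature_null x y : Rm u x y = 0.
Proof.
apply: (ip_nondeg (g := g)) => z; rewrite curvature_pair.
by have [_ _ _ -> _] := PP; rewrite ip0l.
Qed.

Lemma curvature_screen x : Rm e1 e2 x = 0.
Proof. by have [_ _ _ _] := PP; apply; rewrite FE. Qed.

(** Plane rotations commute, so the screen curvature is minus [w] of the bracket. By pair symmetry
    it equals a component of [Rm e1 e2], which vanishes by transversal flatness. *)
Lemma screen_form_closed x y : w (g x y) = 0.
Proof.
have : <|Rm x y e1, e2|> = 0 by rewrite curvature_pair curvature_screen ip0l.
rewrite /curvature !ipBl (nab_metric g x) (nab_metric g y (nab x e1)).
rewrite !nab_e1 !nab_e2 !ip_lin !FE; lra.
Qed.

Lemma shear_curvature1 x y : <|Rm x y m, e1|> =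
  a x * b1 y - a y * b1 x - w x * b2 y + w y * b2 x - b1 (g x y).
Proof.
rewrite /curvature !ipBl (nab_metric g x) (nab_metric g y (nab x m)) (nab_metric g (g x y)).
rewrite !nab_m !nab_e1 !ip_lin !FE; ring.
Qed.

Lemma shear_curvature2 x y : <|Rm x y m, e2|> =
  a x * b2 y - a y * b2 x + w x * b1 y - w y * b1 x - b2 (g x y).
Proof.
rewrite /curvature !ipBl (nab_metric g x) (nab_metric g y (nab x m)) (nab_metric g (g x y)).
rewrite !nab_m !nab_e2 !ip_lin !FE; ring.
Qed.

(** The operator [Rm x y] is skew, kills [u] and has no rotation part on the screen. What is left
    are its components [<|Rm x y m, e1|>] and [<|Rm x y m, e2|>]. *)
Lemma flat_of_shear :
  (forall x y, a x * b1 y - a y * b1 x - w x * b2 y + w y * b2 x - b1 (g x y) = 0) ->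
  (forall x y, a x * b2 y - a y * b2 x + w x * b1 y - w y * b1 x - b2 (g x y) = 0) ->
  flat g.
Proof.
move=> H1 H2.
have M x y v : <|Rm x y v, v|> = 0.
  by have := curvature_metric g x y v v; lra.
have Ru x y : Rm x y u = 0 by case: PP.
have Rm_m x y : Rm x y m = 0.
  rewrite (null_frame_decomp (Rm x y m) F) shear_curvature1 shear_curvature2 H1 H2 M.
  by rewrite (curvature_metric g x y m u) Ru ip0l oppr0 !scale0r !addr0.
have R1 x y : Rm x y e1 = 0.
  rewrite (null_frame_decomp (Rm x y e1) F) M (curvature_metric g x y e1 u) Ru.
  rewrite (curvature_metric g x y e1 m) Rm_m (curvature_pair g x y e1 e2).
  by rewrite curvature_screen !ip0l oppr0 !scale0r !addr0.
have R2 x y : Rm x y e2 = 0.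
  rewrite (null_frame_decomp (Rm x y e2) F) M (curvature_metric g x y e2 u) Ru.
  by rewrite (curvature_metric g x y e2 m) Rm_m (curvature_metric g x y e2 e1) R1
    !ip0l oppr0 !scale0r !addr0.
move=> x y z; rewrite (null_frame_decomp z F) !curvatureDr !curvatureZr.
by rewrite Ru R1 R2 Rm_m !scaler0 !addr0.
Qed.

Lemma frame_brackets :
  (g u e1 = w u *: e2 - (b1 u + a e1) *: u) *
  (g u e2 = - w u *: e1 - (b2 u + a e2) *: u) *
  (g e1 e2 = - w e1 *: e1 - w e2 *: e2 + (b1 e2 - b2 e1) *: u) *
  (g u m = b1 u *: e1 + b2 u *: e2 - a u *: m - a m *: u) *
  (g e1 m = - a e1 *: m + b1 e1 *: e1 + (b2 e1 - w m) *: e2 + b1 m *: u) *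
  (g e2 m = - a e2 *: m + (b1 e2 + w m) *: e1 + b2 e2 *: e2 + b2 m *: u).
Proof.
do !split; rewrite nab_torsion ?nab_u ?nab_e1 ?nab_e2 ?nab_m;
  apply/rowP => k; rewrite !mxE; ring.
Qed.

Lemma line_form_closed_frame :
  (w u * a e2 - (b1 u + a e1) * a u = 0) *
  (- w u * a e1 - (b2 u + a e2) * a u = 0) *
  (- w e1 * a e1 - w e2 * a e2 + (b1 e2 - b2 e1) * a u = 0) *
  (b1 u * a e1 + b2 u * a e2 - a u * a m - a m * a u = 0) *
  (- a e1 * a m + b1 e1 * a e1 + (b2 e1 - w m) * a e2 + b1 m * a u = 0) *
  (- a e2 * a m + (b1 e2 + w m) * a e1 + b2 e2 * a e2 + b2 m * a u = 0).
Proof.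
have L := form_linE line_form_linear.
do !split.
- by have := line_form_closed u e1; rewrite !frame_brackets !L.
- by have := line_form_closed u e2; rewrite !frame_brackets !L.
- by have := line_form_closed e1 e2; rewrite !frame_brackets !L.
- by have := line_form_closed u m; rewrite !frame_brackets !L.
- by have := line_form_closed e1 m; rewrite !frame_brackets !L.
- by have := line_form_closed e2 m; rewrite !frame_brackets !L.
Qed.

Lemma screen_form_closed_frame :
  (w u * w e2 - (b1 u + a e1) * w u = 0) *
  (- w u * w e1 - (b2 u + a e2) * w u = 0) *
  (- w e1 * w e1 - w e2 * w e2 + (b1 e2 - b2 e1) * w u = 0) *
  (b1 u * w e1 + b2 u * w e2 - a u * w m - a m * w u = 0) *
  (- a e1 * w m + b1 e1 * w e1 + (b2 e1 - w m) * w e2 + b1 m * w u = 0) *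
  (- a e2 * w m + (b1 e2 + w m) * w e1 + b2 e2 * w e2 + b2 m * w u = 0).
Proof.
have L := form_linE screen_form_linear.
do !split.
- by have := screen_form_closed u e1; rewrite !frame_brackets !L.
- by have := screen_form_closed u e2; rewrite !frame_brackets !L.
- by have := screen_form_closed e1 e2; rewrite !frame_brackets !L.
- by have := screen_form_closed u m; rewrite !frame_brackets !L.
- by have := screen_form_closed e1 m; rewrite !frame_brackets !L.
- by have := screen_form_closed e2 m; rewrite !frame_brackets !L.
Qed.

(** The first six equations are the vanishing of the curvature on [u], [e1], on [u], [e2] and on
    [e1], [e2]. The last is pair symmetry for the two remaining planes. *)
Lemma shear_form_frame :
  (a u * b1 e1 - a e1 * b1 u - w u * b2 e1 + w e1 * b2 u
    - (w u * b1 e2 - (b1 u + a e1) * b1 u) = 0) *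
  (a u * b2 e1 - a e1 * b2 u + w u * b1 e1 - w e1 * b1 u
    - (w u * b2 e2 - (b1 u + a e1) * b2 u) = 0) *
  (a u * b1 e2 - a e2 * b1 u - w u * b2 e2 + w e2 * b2 u
    - (- w u * b1 e1 - (b2 u + a e2) * b1 u) = 0) *
  (a u * b2 e2 - a e2 * b2 u + w u * b1 e2 - w e2 * b1 u
    - (- w u * b2 e1 - (b2 u + a e2) * b2 u) = 0) *
  (a e1 * b1 e2 - a e2 * b1 e1 - w e1 * b2 e2 + w e2 * b2 e1
    - (- w e1 * b1 e1 - w e2 * b1 e2 + (b1 e2 - b2 e1) * b1 u) = 0) *
  (a e1 * b2 e2 - a e2 * b2 e1 + w e1 * b1 e2 - w e2 * b1 e1
    - (- w e1 * b2 e1 - w e2 * b2 e2 + (b1 e2 - b2 e1) * b2 u) = 0) *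
  (a e2 * b1 m - a m * b1 e2 - w e2 * b2 m + w m * b2 e2
    - (- a e2 * b1 m + (b1 e2 + w m) * b1 e1 + b2 e2 * b1 e2 + b2 m * b1 u) =
   a e1 * b2 m - a m * b2 e1 + w e1 * b1 m - w m * b1 e1
    - (- a e1 * b2 m + b1 e1 * b2 e1 + (b2 e1 - w m) * b2 e2 + b1 m * b2 u)).
Proof.
have L1 := form_linE (shear_form_linear e1).
have L2 := form_linE (shear_form_linear e2).
do !split.
- by have := shear_curvature1 u e1; rewrite !frame_brackets !L1 curvature_null ip0l.
- by have := shear_curvature2 u e1; rewrite !frame_brackets !L2 curvature_null ip0l.
- by have := shear_curvature1 u e2; rewrite !frame_brackets !L1 curvature_null ip0l.
- by have := shear_curvature2 u e2; rewrite !frame_brackets !L2 curvature_null ip0l.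
- by have := shear_curvature1 e1 e2; rewrite !frame_brackets !L1 curvature_screen ip0l.
- by have := shear_curvature2 e1 e2; rewrite !frame_brackets !L2 curvature_screen ip0l.
have := shear_curvature1 e2 m; have := shear_curvature2 e1 m.
rewrite !frame_brackets !L1 !L2 => <- <-.
by rewrite (curvature_pair g e2) curvature_skew ipNl curvature_metric opprK.
Qed.

End StructureEquations.

(** * Classification *)

(** The unknowns form a symmetric matrix on which an infinitesimal rotation of speed [W] acts with
    eigenvalues 0 and plus or minus [2 W i]; a nonzero real [A] is none of the nonzero ones.
    Concretely, the determinant is [A * (A ^+ 2 + 4 * W ^+ 2)]. *)
Lemma null_rotation_system {R : realFieldType} (A W s t r : R) : A != 0 ->
  A * s = 2 * W * t -> A * t + W * (s - r) = 0 -> A * r = - (2 * W * t) ->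
  [/\ s = 0, t = 0 & r = 0].
Proof.
move=> A0 h1 h2 h3.
have rs : r = - s.
  by apply: (mulfI A0); rewrite h3 mulrN h1.
have pos : 0 < A ^+ 2 + 4 * W ^+ 2.
  rewrite ltr_pwDl //; first by rewrite lt_def sqrf_eq0 A0 sqr_ge0.
  by rewrite mulr_ge0 ?sqr_ge0.
have s0 : s = 0.
  apply: (mulfI (lt0r_neq0 pos)); rewrite mulr0 mulrDl.
  have -> : A ^+ 2 * s = 2 * W * (A * t) by rewrite expr2 -mulrA h1; ring.
  have -> : A * t = - (2 * W * s) by move: h2; rewrite rs; lra.
  ring.
split=> //; last by rewrite rs s0 oppr0.
by apply: (mulfI A0); move: h2; rewrite rs s0; lra.
Qed.

(** The double angle of the rotation is that of the vector [(D, A)] of length [r], and [(D + r, A)]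
    points along the half angle. *)
Lemma diagonalizing_rotation {R : rcfType} (A D : R) :
  exists c s, c ^+ 2 + s ^+ 2 = 1 /\ (c ^+ 2 - s ^+ 2) * A = 2 * c * s * D.
Proof.
have [->|A0] := eqVneq A 0; first by exists 1, 0; split; ring.
pose r := Num.sqrt (A ^+ 2 + D ^+ 2).
have r2 : r ^+ 2 = A ^+ 2 + D ^+ 2 by rewrite sqr_sqrtr // addr_ge0 ?sqr_ge0.
pose n2 := (D + r) ^+ 2 + A ^+ 2.
have n20 : 0 < n2.
  by rewrite ltr_wpDl ?sqr_ge0 // lt_def sqrf_eq0 A0 sqr_ge0.
pose n := Num.sqrt n2.
have nn : n ^+ 2 = n2 by rewrite sqr_sqrtr // ltW.
have n0 : n != 0 by rewrite -sqrf_eq0 nn lt0r_neq0.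
exists ((D + r) / n), (A / n); split.
  by rewrite !expr_div_n nn -mulrDl divff // lt0r_neq0.
have -> : ((D + r) / n) ^+ 2 - (A / n) ^+ 2 = 2 * D * (D + r) / n ^+ 2.
  rewrite !expr_div_n -mulrBl; congr (_ / _).
  have -> : A ^+ 2 = r ^+ 2 - D ^+ 2 by rewrite r2; ring.
  ring.
by field.
Qed.

Section Classification.
Context {R : realType} (g : metricLieAlgebra R 4).
Context (u : 'rV[R]_4) (a : 'rV[R]_4 -> R).
Hypothesis PP : pp_vector g u a.
Implicit Types (x y z v e m : 'rV[R]_4).
Local Notation "<| x , y |>" := (ip g x y) (at level 0, format "<| x ,  y |>").

Lemma form_eq0 (l : 'rV[R]_4 -> R) e1 e2 m : null_frame g u e1 e2 m ->
  (forall c x y, l (c *: x + y) = c * l x + l y) ->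
  l u = 0 -> l e1 = 0 -> l e2 = 0 -> l m = 0 -> forall x, l x = 0.
Proof.
move=> F L lu l1 l2 lm x; have LE := form_linE L.
by rewrite (null_frame_decomp x F) !LE lu l1 l2 lm !mulr0 !addr0.
Qed.

Lemma flat_of_shear0 e1 e2 m : null_frame g u e1 e2 m ->
  (forall x, shear_form g m e1 x = 0) -> (forall x, shear_form g m e2 x = 0) ->
  flat g.
Proof.
move=> F b1 b2; apply: (flat_of_shear F PP) => x y; rewrite !b1 !b2; ring.
Qed.

(** Cancelling [a u] in the closedness of [a] kills the shear at [u] and [m] and makes it symmetric
    on the screen. Closedness of [w] then removes [w e1] and [w e2], and the rest of the shear
    solves [null_rotation_system]. *)
Lemma flat_of_line_form_null e1 e2 m : null_frame g u e1 e2 m ->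
  a u != 0 -> a e1 = 0 -> a e2 = 0 -> flat g.
Proof.
move=> F au0 a1 a2.
have SA := line_form_closed_frame F PP; have SW := screen_form_closed_frame F PP.
have SB := shear_form_frame F PP.
have L1 := shear_form_linear g m e1; have L2 := shear_form_linear g m e2.
suff : [/\ [/\ shear_form g m e1 u = 0, shear_form g m e1 e1 = 0,
     shear_form g m e1 e2 = 0 & shear_form g m e1 m = 0] &
     [/\ shear_form g m e2 u = 0, shear_form g m e2 e1 = 0,
     shear_form g m e2 e2 = 0 & shear_form g m e2 m = 0]].
  move=> [[h1 h2 h3 h4] [k1 k2 k3 k4]]; apply: (flat_of_shear0 F).
    exact: (form_eq0 F L1).
  exact: (form_eq0 F L2).
move: SA SW SB; rewrite a1 a2.
move: (a u) au0 (a m) (screen_form _ _ _ u) (screen_form _ _ _ e1)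
  (screen_form _ _ _ e2) (screen_form _ _ _ m)
  (shear_form _ _ e1 u) (shear_form _ _ e1 e1) (shear_form _ _ e1 e2) (shear_form _ _ e1 m)
  (shear_form _ _ e2 u) (shear_form _ _ e2 e1) (shear_form _ _ e2 e2) (shear_form _ _ e2 m).
move=> A A0 am wu w1 w2 wm pu p1 p2 pm qu q1 q2 qm.
move=> [[[[[h1 h2] h3] h4] h5] h6] [[[[[k1 k2] k3] k4] k5] k6].
move=> [[[[[[s1 s2] s3] s4] s5] s6] s7].
have pu0 : pu = 0 by apply: (mulIf A0); lra.
have qu0 : qu = 0 by apply: (mulIf A0); lra.
have pq : p2 = q1 by apply: (mulIf A0); lra.
have pm0 : pm = 0 by apply: (mulIf A0); lra.
have qm0 : qm = 0 by apply: (mulIf A0); lra.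
have W : w1 ^+ 2 + w2 ^+ 2 = 0 by move: k3; rewrite pq; lra.
have [w10 w20] := sum_sqr_eq0 W.
subst pu qu pm qm w1 w2 p2.
have [->-> ->] : [/\ p1 = 0, q1 = 0 & q2 = 0].
  by apply: (null_rotation_system (W := wu) A0); lra.
by [].
Qed.

Lemma homothetic_model1 e1 e2 m : null_frame g u e1 e2 m ->
  a u = 0 -> a e1 = 0 -> a e2 != 0 -> a m = 0 -> ~ flat g ->
  exists g1 g3 : R, g1 != 0 /\ isomorphically_homothetic g (model1 g1 g3).
Proof.
move=> F au a1 a20 am nflat.
have FE := null_frameE F; have BR := frame_brackets F PP.
have SA := line_form_closed_frame F PP; have SW := screen_form_closed_frame F PP.
have SB := shear_form_frame F PP.
have L1 := shear_form_linear g m e1; have L2 := shear_form_linear g m e2.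
have Lw := screen_form_linear g e1 e2; have La := line_form_linear F PP.
set w := screen_form g e1 e2 in SA SW SB BR Lw.
set b1 := shear_form g m e1 in SA SW SB BR L1.
set b2 := shear_form g m e2 in SA SW SB BR L2.
(* Cancelling [a e2] throughout leaves only [a e2], [b1 e2] and [b2 m] free. *)
have [W [P [Q [bu0 be1 bm0]]]] : [/\ w u = 0, w e1 = 0, w e2 = 0 & w m = 0] /\
    [/\ b2 u = 0, b2 e1 = 0 & b2 e2 = 0] /\ True /\ [/\ b1 u = 0, b1 e1 = 0 & b1 m = 0].
  move: SA SW SB; rewrite au a1 am.
  move: (a e2) a20 (w u) (w e1) (w e2) (w m) (b1 u) (b1 e1) (b1 e2) (b1 m)
    (b2 u) (b2 e1) (b2 e2) (b2 m).
  move=> A A0 wu w1 w2 wm pu p1 p2 pm qu q1 q2 qm.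
  move=> [[[[[h1 h2] h3] h4] h5] h6] [[[[[k1 k2] k3] k4] k5] k6].
  move=> [[[[[[s1 s2] s3] s4] s5] s6] s7].
  have wu0 : wu = 0 by apply: (mulIf A0); lra.
  have qu0 : qu = 0 by apply: (mulIf A0); lra.
  have w20 : w2 = 0 by apply: (mulIf A0); lra.
  have qw : q1 = wm by apply: (mulIf A0); lra.
  have q20 : q2 = 0 by apply: (mulIf A0); lra.
  subst wu qu w2 q1 q2.
  have w10 : w1 = 0 by apply/eqP; rewrite -sqrf_eq0; apply/eqP; lra.
  subst w1; have wm0 : wm = 0 by apply: (mulIf A0); lra.
  subst wm; have pu0 : pu = 0 by apply/eqP; rewrite -sqrf_eq0; apply/eqP; lra.
  subst pu; have p10 : p1 = 0 by apply: (mulIf A0); lra.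
  subst p1; have pm0 : pm = 0 by apply: (mulIf A0); lra.
  by subst pm.
have [wu w1 w2 wm] := W; have [qu q1 q2] := P.
have w0 := form_eq0 F Lw wu w1 w2 wm.
rewrite au a1 am wu w1 w2 wm bu0 be1 bm0 qu q1 q2 in BR.
(* Otherwise [b2] vanishes and [b1] is a multiple of the closed form [a], which makes the shear
   curvature zero. *)
have b20 : b2 m != 0.
  apply/eqP => qm; apply: nflat; have b20 := form_eq0 F L2 qu q1 q2 qm.
  have b1a x : b1 x = b1 e2 / a e2 * a x.
    have L c y z : b1 (c *: y + z) - b1 e2 / a e2 * a (c *: y + z) =
       c * (b1 y - b1 e2 / a e2 * a y) + (b1 z - b1 e2 / a e2 * a z).
      by rewrite L1 La; ring.
    apply/eqP; rewrite -subr_eq0; apply/eqP.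
    apply: (form_eq0 (l := fun x => b1 x - b1 e2 / a e2 * a x) F L).
    - by rewrite bu0 au; ring.
    - by rewrite be1 a1; ring.
    - by rewrite divfK // subrr.
    - by rewrite bm0 am; ring.
  have ac := line_form_closed F PP.
  have H1 x y : a x * b1 y - a y * b1 x - w x * b2 y + w y * b2 x - b1 (g x y) = 0.
    by rewrite (b1a x) (b1a y) (b1a (g x y)) ac !w0; ring.
  have H2 x y : a x * b2 y - a y * b2 x + w x * b1 y - w y * b1 x - b2 (g x y) = 0.
    by rewrite !w0 !b20; ring.
  exact: (flat_of_shear F PP H1 H2).
(* In the frame [k^-1 *: m], [k *: u], [e1], [s *: e2], the coefficient of [u_2] in [[u_1, u_4]] is
   [- (s * b2 m) / k ^+ 2], which must be 1. The reflection [s] corrects its sign and the boost [k]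
   its size. *)
have [s [k [s2 k0 sk]]] : exists s k : R, [/\ s ^+ 2 = 1, k != 0 & - (s * b2 m) = k ^+ 2].
  have [b|b] : b2 m < 0 \/ 0 < b2 m by apply/orP; rewrite -neq_lt.
    exists 1, (Num.sqrt (- b2 m)); split; first by rewrite expr1n.
      by rewrite sqrtr_eq0 -ltNge oppr_gt0.
    by rewrite mul1r sqr_sqrtr // oppr_ge0 ltW.
  exists (-1), (Num.sqrt (b2 m)); split; first by rewrite sqrrN expr1n.
    by rewrite sqrtr_eq0 -ltNge.
  by rewrite mulN1r opprK sqr_sqrtr // ltW.
have F' : null_frame g (k *: u) e1 (s *: e2) (k^-1 *: m).
  split; split; rewrite ?ip_lin ?FE ?mulr0 //; first by field.
  by rewrite mulr1 -expr2.
exists (s * a e2), (s * b1 e2 / k); split.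
  by rewrite mulf_neq0 // -sqrf_eq0 s2 oner_eq0.
apply: (homothetic_of_frame _ _ (null_frame_gram_u F')).
have s1 : (s == 1) || (s == -1) by rewrite -sqrf_eq1 s2.
have bk : b2 m = - s * k ^+ 2 by rewrite -sk mulrNN mulrA -expr2 s2 mul1r.
move=> [[|[|[|[|i]]]] // ?] [[|[|[|[|j]]]] // ?] //= _;
  rewrite !row_rows4 /= ?row4_mul_rows4 ?mul0mx ?(brZl, brZr).
- by rewrite (br_skew g u m) BR; apply/rowP => i; rewrite !mxE; ring.
- by rewrite (br_skew g e1 m) BR; apply/rowP => i; rewrite !mxE; ring.
- rewrite (br_skew g e2 m) BR bk; apply/rowP => i; rewrite !mxE.
  by case/orP: s1 => /eqP ->; field.
- by rewrite BR; apply/rowP => i; rewrite !mxE; ring.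
- by rewrite BR; apply/rowP => i; rewrite !mxE; ring.
- by rewrite BR; apply/rowP => i; rewrite !mxE; field.
Qed.

(** The shear on the screen must commute with the rotation along [u] and be symmetric, hence it is
    the scalar [b1 e1]. If that scalar were zero, all shear would vanish and the metric would be
    flat. *)
Lemma homothetic_model5 e1 e2 m : null_frame g u e1 e2 m ->
  a u = 0 -> a e1 = 0 -> a e2 = 0 -> screen_form g e1 e2 u != 0 ->
  screen_form g e1 e2 e1 = 0 -> screen_form g e1 e2 e2 = 0 -> ~ flat g ->
  exists g1 g2 : R, g1 != 0 /\ isomorphically_homothetic g (model5 g1 g2).
Proof.
move=> F au a1 a2 wu0 w1 w2 nflat.
have FE := null_frameE F; have BR := frame_brackets F PP.
have SA := line_form_closed_frame F PP; have SW := screen_form_closed_frame F PP.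
have SB := shear_form_frame F PP.
have L1 := shear_form_linear g m e1; have L2 := shear_form_linear g m e2.
set w := screen_form g e1 e2 in SA SW SB BR wu0 w1 w2.
set b1 := shear_form g m e1 in SA SW SB BR L1.
set b2 := shear_form g m e2 in SA SW SB BR L2.
have [am [pu p2 pm] [qu q1 q2 qm]] : [/\ a m = 0, [/\ b1 u = 0, b1 e2 = 0 & b1 m = 0] &
    [/\ b2 u = 0, b2 e1 = 0, b2 e2 = b1 e1 & b2 m = 0]].
  move: SA SW SB; rewrite au a1 a2 w1 w2.
  move: (a m) (w u) wu0 (w m) (b1 u) (b1 e1) (b1 e2) (b1 m)
    (b2 u) (b2 e1) (b2 e2) (b2 m).
  move=> am W W0 wm pu p1 p2 pm qu q1 q2 qm.
  move=> [[[[[h1 h2] h3] h4] h5] h6] [[[[[k1 k2] k3] k4] k5] k6].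
  move=> [[[[[[s1 s2] s3] s4] s5] s6] s7].
  have pu0 : pu = 0 by apply: (mulIf W0); lra.
  have qu0 : qu = 0 by apply: (mulIf W0); lra.
  have p2q : p2 = q1 by apply: (mulIf W0); lra.
  subst pu qu p2.
  have am0 : am = 0 by apply: (mulIf W0); lra.
  have pm0 : pm = 0 by apply: (mulIf W0); lra.
  have qm0 : qm = 0 by apply: (mulIf W0); lra.
  have q10 : q1 = 0 by apply: (mulIf W0); lra.
  have pq : q2 = p1 by apply: (mulIf W0); lra.
  by subst.
rewrite au a1 a2 am w1 w2 pu p2 pm qu q1 q2 qm in BR.
have p10 : b1 e1 != 0.
  apply/eqP => p1; apply: nflat; apply: (flat_of_shear0 F).
    exact: (form_eq0 F L1).
  by apply: (form_eq0 F L2); rewrite // q2.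
(* The boost that normalises the rotation speed, giving [[v_1, v_3] = v_2]. *)
pose k := - (w u)^-1; have k0 : k != 0 by rewrite oppr_eq0 invr_eq0.
have kw : k^-1 = - w u by rewrite /k invrN invrK.
exists (b1 e1 / k), (- w m / k); split; first by rewrite mulf_neq0 ?invr_eq0.
have F' := null_boost k0 F.
apply: (homothetic_of_frame _ _ (null_frame_gram F')).
move=> [[|[|[|[|i]]]] // ?] [[|[|[|[|j]]]] // ?] //= _;
  rewrite !row_rows4 /= ?row4_mul_rows4 ?mul0mx ?(brZl, brZr).
- by rewrite BR; apply/rowP => i; rewrite !mxE; ring.
- rewrite (br_skew g u e1) BR; apply/rowP => i; rewrite !mxE /k; field.
  exact: wu0.
- by rewrite BR; apply/rowP => i; rewrite !mxE; ring.
- rewrite (br_skew g u e2) BR; apply/rowP => i; rewrite !mxE /k; field.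
  exact: wu0.
- by rewrite BR; apply/rowP => i; rewrite !mxE; ring.
- by rewrite BR; apply/rowP => i; rewrite !mxE; ring.
Qed.

Lemma homothetic_model34 e1 e2 m : null_frame g u e1 e2 m ->
  a u = 0 -> a e1 = 0 -> a e2 = 0 -> screen_form g e1 e2 u = 0 ->
  shear_form g m e1 e2 + shear_form g m e2 e1 = 0 ->
  (exists g1 g2 g3 g4 g5 g8 : R,
      isomorphically_homothetic g (model3 g1 g2 g3 g4 g5 g8)) \/
  (exists g1 g2 g3 g4 g5 : R,
      isomorphically_homothetic g (model4 g1 g2 g3 g4 g5)).
Proof.
move=> F au a1 a2 wu sym.
have FE := null_frameE F; have BR := frame_brackets F PP.
have SW := screen_form_closed_frame F PP; have SB := shear_form_frame F PP.
set w := screen_form g e1 e2 in SW SB BR wu.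
set b1 := shear_form g m e1 in SW SB BR sym.
set b2 := shear_form g m e2 in SW SB BR sym.
(* The relation [tr] is the pair symmetry equation and decides between the models: either [[e1, e2]]
   vanishes, or the action of [m] has the weight on the centre that a derivation of the Heisenberg
   algebra requires. *)
have [w1 w2 pu qu tr] : [/\ w e1 = 0, w e2 = 0, b1 u = 0, b2 u = 0 &
    b1 e2 * (a m + b1 e1 + b2 e2) = 0].
  move: SW SB sym; rewrite au a1 a2 wu.
  move: (a m) (w e1) (w e2) (w m) (b1 u) (b1 e1) (b1 e2) (b1 m)
    (b2 u) (b2 e1) (b2 e2) (b2 m).
  move=> am w1 w2 wm pu p1 p2 pm qu q1 q2 qm.
  move=> [[[[[k1 k2] k3] k4] k5] k6].
  move=> [[[[[[s1 s2] s3] s4] s5] s6] s7] /eqP.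
  rewrite addrC addr_eq0 => /eqP q1E; subst q1.
  have [w10 w20] : w1 = 0 /\ w2 = 0 by apply: sum_sqr_eq0; lra.
  subst w1 w2.
  have pu0 : pu = 0 by apply/eqP; rewrite -sqrf_eq0; apply/eqP; lra.
  have qu0 : qu = 0 by apply/eqP; rewrite -sqrf_eq0; apply/eqP; lra.
  by subst; split=> //; lra.
rewrite au a1 a2 wu w1 w2 pu qu in BR.
have q1 : b2 e1 = - b1 e2 by apply/eqP; rewrite -addr_eq0 addrC sym.
rewrite q1 in BR.
have [p2|p20] := eqVneq (b1 e2) 0.
  left; exists (b1 e1), (w m), (b1 m), (b2 e2), (b2 m), (- a m).
  apply: (homothetic_of_frame _ _ (null_frame_gram F)); rewrite p2 in BR.
  move=> [[|[|[|[|i]]]] // ?] [[|[|[|[|j]]]] // ?] //= _;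
    rewrite !row_rows4 /= ?row4_mul_rows4 ?mul0mx;
    rewrite ?(br_skew g u e1) ?(br_skew g u e2) BR; apply/rowP => i; rewrite !mxE; ring.
(* Here [[e1, e2] = k *: u], so the boosted null vector is exactly this commutator. *)
right; pose k := 2 * b1 e2; have k0 : k != 0 by rewrite mulf_neq0 // pnatr_eq0.
have am : a m = - (b1 e1 + b2 e2).
  by move/eqP: tr; rewrite mulf_eq0 (negPf p20) /= => /eqP; lra.
exists (b1 e1 / k), ((b1 e2 + w m) / k), (b1 m / k ^+ 2), (b2 e2 / k), (b2 m / k ^+ 2).
apply: (homothetic_of_frame _ _ (null_frame_gram (null_boost k0 F))).
rewrite am in BR.
move=> [[|[|[|[|i]]]] // ?] [[|[|[|[|j]]]] // ?] //= _;
  rewrite !row_rows4 /= ?row4_mul_rows4 ?mul0mx ?(brZl, brZr).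
- by rewrite BR; apply/rowP => i; rewrite !mxE /k; ring.
- by rewrite (br_skew g u e1) BR; apply/rowP => i; rewrite !mxE; ring.
- by rewrite BR; apply/rowP => i; rewrite !mxE; field.
- by rewrite (br_skew g u e2) BR; apply/rowP => i; rewrite !mxE; ring.
- by rewrite BR; apply/rowP => i; rewrite !mxE; field.
- by rewrite BR; apply/rowP => i; rewrite !mxE; field.
Qed.

End Classification.

Section ClassificationByFrameChange.
Context {R : realType} (g : metricLieAlgebra R 4).
Context (u : 'rV[R]_4) (a : 'rV[R]_4 -> R).
Hypothesis PP : pp_vector g u a.

(** The form belongs to the connection induced on the orthogonal of [u] modulo [u], which null
    rotations do not affect. *)
Lemma screen_form_null_rotation e1 e2 m (c1 c2 : R) x :
  null_frame g u e1 e2 m ->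
  screen_form g (e1 + c1 *: u) (e2 + c2 *: u) x = screen_form g e1 e2 x.
Proof.
move=> F; have FE := null_frameE F.
rewrite /screen_form !nab_lin (nab_u PP) !ip_lin !FE.
by rewrite (nab_metric g x e1 u) (nab_u PP) ipZr FE; ring.
Qed.

Lemma screen_form_rotation e1 e2 m (c s : R) x : c ^+ 2 + s ^+ 2 = 1 ->
  null_frame g u e1 e2 m ->
  screen_form g (c *: e1 + s *: e2) (- s *: e1 + c *: e2) x =
  screen_form g e1 e2 x.
Proof.
move=> cs F; rewrite /screen_form !nab_lin !ip_lin.
rewrite (nab_metric g x e2 e1) !nab_self (ip_sym g e2 (levi_civita g x e1)).
by rewrite -[RHS]mul1r -cs; ring.
Qed.

Lemma shear_form_rotation e1 e2 m (c s : R) :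
  (c ^+ 2 - s ^+ 2) * (shear_form g m e1 e2 + shear_form g m e2 e1) =
    2 * c * s * (shear_form g m e1 e1 - shear_form g m e2 e2) ->
  shear_form g m (c *: e1 + s *: e2) (- s *: e1 + c *: e2) +
  shear_form g m (- s *: e1 + c *: e2) (c *: e1 + s *: e2) = 0.
Proof. by rewrite /shear_form !nab_lin !ip_lin; ip_abstract; lra. Qed.

Lemma pp_vector_classification : ~ flat g ->
  (exists g1 g3 : R,
      g1 != 0 /\ isomorphically_homothetic g (model1 g1 g3)) \/
  (exists g1 g2 g3 g4 g5 g8 : R,
      isomorphically_homothetic g (model3 g1 g2 g3 g4 g5 g8)) \/
  (exists g1 g2 g3 g4 g5 : R,
      isomorphically_homothetic g (model4 g1 g2 g3 g4 g5)) \/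
  (exists g1 g2 : R,
      g1 != 0 /\ isomorphically_homothetic g (model5 g1 g2)).
Proof.
move=> nflat; have [u0 uu _ _ _] := PP.
have [e1 [e2 [m F]]] := null_frame_exists u0 uu.
have La := form_linE (line_form_linear F PP).
have [au|au] := eqVneq (a u) 0; last first.
  case: nflat.
  apply: (flat_of_line_form_null PP (null_rotation (- a e1 / a u) (- a e2 / a u) F)) => //;
    by rewrite !La; field.
have [a12|a12] := eqVneq (a e1 ^+ 2 + a e2 ^+ 2) 0; last first.
  left; have pos : 0 < a e1 ^+ 2 + a e2 ^+ 2.
    by rewrite lt_def a12 addr_ge0 ?sqr_ge0.
  pose r := Num.sqrt (a e1 ^+ 2 + a e2 ^+ 2).
  have r2 : r ^+ 2 = a e1 ^+ 2 + a e2 ^+ 2 by rewrite sqr_sqrtr // ltW.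
  have r0 : r != 0 by rewrite sqrtr_eq0 -ltNge.
  have cs : (a e2 / r) ^+ 2 + (- a e1 / r) ^+ 2 = 1.
    by rewrite !expr_div_n sqrrN -mulrDl addrC -r2 divff // expf_eq0.
  have F1 := screen_rotation cs F.
  set e1' := _ *: e1 + _ in F1; set e2' := _ *: e1 + _ in F1.
  have a1 : a e1' = 0 by rewrite /e1' !La; field.
  have a2 : a e2' = r.
    by rewrite /e2' !La -[RHS](mulfK r0) -expr2 r2; field.
  move: e1' e2' F1 a1 a2 => e1' e2' F1 a1 a2.
  (* The screen rotation has concentrated [a] on the second screen vector, with value [r];
     subtracting [a m / r] times that vector from [m] removes [a m]. *)
  have F2 := null_rotation 0 (a m / r) F1.
  apply: (homothetic_model1 PP F2) => //; rewrite !La ?a1 ?a2 ?au.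
  - by ring.
  - by rewrite mulr0 addr0.
  by field.
have [a10 a20] := sum_sqr_eq0 a12.
right; have Lw := form_linE (screen_form_linear g e1 e2).
have [wu|wu] := eqVneq (screen_form g e1 e2 u) 0; last first.
  right; right.
  set w := screen_form g e1 e2 in wu Lw.
  have F1 := null_rotation (- w e1 / w u) (- w e2 / w u) F.
  apply: (homothetic_model5 PP F1) => //;
    rewrite ?(screen_form_null_rotation _ _ _ F) //
      ?La ?a10 ?a20 ?au ?mulr0 ?addr0 // -/w !Lw.
    by field.
  by field.
(* The rotation removes the off-diagonal entry of the symmetric part of the shear, leaving its
   antisymmetric part for the bracket of the screen vectors. *)
have [c [s [cs H]]] := diagonalizing_rotation
  (shear_form g m e1 e2 + shear_form g m e2 e1)
  (shear_form g m e1 e1 - shear_form g m e2 e2).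
have F1 := screen_rotation cs F.
have := homothetic_model34 PP F1 au.
rewrite !La a10 a20 !mulr0 addr0 (screen_form_rotation _ cs F) (shear_form_rotation H).
by move=> /(_ erefl erefl wu erefl) [|]; [left|right; left].
Qed.

End ClassificationByFrameChange.

(** * Parallel fields *)

Lemma row_linear_continuous {R : realType} {n : nat}
  (L : {linear 'rV[R]_n -> R^o}) : continuous L.
Proof.
have LE : L = (fun x : 'rV[R]_n => \sum_i x 0 i * L (delta_mx 0 i)) :> (_ -> R).
  apply/funext => x; rewrite {1}[x]row_sum_delta linear_sum.
  by apply: eq_bigr => i _; rewrite linearZ.
have C : Ck_on 0 setT ((fun x : 'rV[R]_n => \sum_i x 0 i * L (delta_mx 0 i)) : _ -> R^o).
  apply: Ck_on_sum => [|i]; first exact: openT.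
  apply: (Ck_on_mul (f := fun x : 'rV[R]_n => x 0 i : R^o) openT); last exact: Ck_on_cst.
  by move=> x _; exact: coord_continuous.
by rewrite LE => x; exact: C.
Qed.

Section ParallelFields.
Context {R : realType} {n : nat} (G : lieGroup R n) (kappa : chart R n G).
Context (kappa_chart : lg_atlas kappa) (kappa_one : cdom kappa 1%g).
Context (g : metricLieAlgebra R n) (g_lie : lie_algebra_of kappa g).
Implicit Types (x y z w : 'rV[R]_n) (O : set G) (V : G -> 'rV[R]_n).
Local Notation "<| x , y |>" := (ip g x y) (at level 0, format "<| x ,  y |>").
Local Notation nab := (levi_civita g).

Lemma lieder_form (l : 'rV[R]_n -> R^o) x O V q : linear l ->
  open O -> smooth_in O V -> O q ->
  lieder kappa x (fun r => l (V r)) q = l (lieder kappa x V q) /\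
  smooth_in O (fun r => l (V r)).
Proof.
move=> ll oO sV Oq.
pose L : {linear 'rV[R]_n -> R^o} := HB.pack l (GRing.isLinear.Build _ _ _ _ l ll).
have cL : continuous L by exact: row_linear_continuous.
split; last exact: (smooth_in_linear (L := L)).
exact: (lieder_linear (L := L) kappa_chart kappa_one x (has_coordinates_row R n) cL oO sV Oq).
Qed.

Lemma parallel_lieder O V x q : parallel_on kappa g O V -> O q ->
  lieder kappa x V q = - nab x (V q).
Proof. by move=> pV Oq; apply/eqP; rewrite -addr_eq0; apply/eqP; exact: pV. Qed.

(** For a parallel [V] the frame derivative is [- nab], so second derivatives of [<|V, w|>] are
    iterated [nab] in reversed order. The commutator relation for this scalar function is then the
    claim paired with [w]. *)
Lemma parallel_curvature O V p x y : open O -> smooth_in O V -> O p ->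
  parallel_on kappa g O V -> curvature g x y (V p) = 0.
Proof.
move=> oO sV Op pV; apply: (ip_nondeg (g := g)) => w.
have l1 z : linear (fun v => <|nab z v, w|> : R^o).
  by move=> c u v; rewrite nabDr nabZr ipDl ipZl.
have l0 : linear (fun v => <|v, w|> : R^o) by move=> c u v; rewrite ipDl ipZl.
have D1 z q : O q -> lieder kappa z (fun r => <|V r, w|> : R^o) q = - <|nab z (V q), w|>.
  move=> Oq; rewrite (lieder_form z l0 oO sV Oq).1 (parallel_lieder z pV Oq).
  by rewrite ipNl.
have D2 z t : lieder kappa z (lieder kappa t (fun r => <|V r, w|> : R^o)) p =
    <|nab t (nab z (V p)), w|>.
  have l2 : linear (fun v => - <|nab t v, w|> : R^o).
    by move=> c u v; rewrite nabDr nabZr ipDl ipZl opprD -mulrN.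
  rewrite (lieder_ext kappa_chart kappa_one z oO Op (D1 t)).
  rewrite (lieder_form z l2 oO sV Op).1 (parallel_lieder z pV Op).
  by rewrite nabNr ipNl opprK.
have := g_lie x y oO (lieder_form 0 l0 oO sV Op).2 Op.
rewrite !D2 D1 // /curvature !ip_lin => H.
by move: H; ip_abstract; lra.
Qed.

End ParallelFields.

Section PPWaveVector.
Context {R : realType} (G : lieGroup R 4) (kappa : chart R 4 G).
Context (kappa_chart : lg_atlas kappa) (kappa_one : cdom kappa 1%g).
Context (g : metricLieAlgebra R 4) (g_lie : lie_algebra_of kappa g).
Implicit Types (x y z u v w : 'rV[R]_4).
Local Notation "<| x , y |>" := (ip g x y) (at level 0, format "<| x ,  y |>").
Local Notation nab := (levi_civita g).
Local Notation Rm := (curvature g).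

Definition curvature_null_vector u : Prop :=
  [/\ u != 0, <|u, u|> = 0, (forall x y, Rm x y u = 0) &
      forall x y z, <|x, u|> = 0 -> <|y, u|> = 0 -> Rm x y z = 0].

(** Orthogonal null vectors are proportional. Otherwise [u] and [v] span a Lorentzian plane
    annihilated by the curvature; pair symmetry leaves only [Rm e1 e2], which is zero since [e1] and
    [e2] are orthogonal to [u]. *)
Lemma curvature_null_vector_unique u v : ~ flat g ->
  curvature_null_vector u -> curvature_null_vector v -> exists k, v = k *: u.
Proof.
move=> nflat [u0 uu Ru Hu] [v0 vv Rv _].
have [uv|uv] := eqVneq <|u, v|> 0; first exact: (null_orthogonal u0 uu vv uv).
case: nflat.
have [m [mm um Rm_m]] : exists m,
    [/\ <|m, m|> = 0, <|u, m|> = 1 & forall x y, Rm x y m = 0].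
  exists (<|u, v|>^-1 *: v); split; first by rewrite !ip_lin vv !mulr0.
    by rewrite ipZr mulVf.
  by move=> x y; rewrite curvatureZr Rv scaler0.
have [e1 [e2 F]] := null_frame_pair uu mm um; have FE := null_frameE F.
have ku x y : Rm u x y = 0.
  by apply: (ip_nondeg (g := g)) => z; rewrite curvature_pair Ru ip0l.
have km x y : Rm m x y = 0.
  by apply: (ip_nondeg (g := g)) => z; rewrite curvature_pair Rm_m ip0l.
have k12 x : Rm e1 e2 x = 0 by apply: Hu; rewrite FE.
have k11 e x : Rm e e x = 0.
  apply: (ip_nondeg (g := g)) => z.
  have := curvature_skew g e e x => /(congr1 (ip g ^~ z)) /=.
  by rewrite ipNl; ip_abstract; lra.
have k1 x y : Rm e1 x y = 0.
  rewrite curvature_skew (null_frame_decomp x F) !curvatureDl !curvatureZl ku km k11.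
  by rewrite curvature_skew k12 oppr0 !scaler0 !addr0 oppr0.
have k2 x y : Rm e2 x y = 0.
  rewrite curvature_skew (null_frame_decomp x F) !curvatureDl !curvatureZl ku km k11.
  by rewrite k12 !scaler0 !addr0 oppr0.
move=> x y z; rewrite (null_frame_decomp x F) !curvatureDl !curvatureZl ku km k1 k2.
by rewrite !scaler0 !addr0.
Qed.

Lemma pp_wave_vector : ~ flat g -> pp_wave kappa g ->
  exists u a, pp_vector g u a.
Proof.
move=> nflat [U [_ _ _ loc curv]].
have nullV O V q : open O -> smooth_in O V -> generates O V U ->
    parallel_on kappa g O V -> null_on g O V -> O q -> curvature_null_vector (V q).
  move=> oO sV gV pV nV Oq; have [V0 UV] := gV q Oq; split => //.
  - exact: nV.
  - by move=> x y; exact: (parallel_curvature kappa_chart kappa_one g_lie x y oO sV Oq pV).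
  move=> x y z xV yV; apply: (curv q); rewrite UV => t /vlineP[k ->].
    by rewrite ipZr xV mulr0.
  by rewrite ipZr yV mulr0.
have [ Om [V [[oO O1 sV gV] [pV nV]]]] := loc 1%g.
pose u := V 1%g; have Nu := nullV Om V 1%g oO sV gV pV nV O1.
have [u0 uu Ru Hu] := Nu; have [e1 [e2 [m F]]] := null_frame_exists u0 uu.
have FE := null_frameE F.
exists u, (fun x => <|nab x u, m|>); split=> // x.
(* By uniqueness [V q] is a multiple of [u] for all nearby [q], so [<|V q, w|>] vanishes identically
   there, and so does its derivative. *)
have key w : <|u, w|> = 0 -> <|nab x u, w|> = 0.
  move=> uw; have l0 : linear (fun v => <|v, w|> : R^o) by move=> c v t; rewrite ipDl ipZl.
  have := (lieder_form kappa_chart kappa_one x l0 oO sV O1).1.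
  rewrite (parallel_lieder x pV O1) ipNl => /esym/eqP; rewrite eqr_oppLR => /eqP ->.
  rewrite (lieder_ext kappa_chart kappa_one x (g := cst 0) oO O1) => [|q Oq].
    by rewrite /lieder derive_cst oppr0.
  have [k ->] := curvature_null_vector_unique nflat Nu (nullV Om V q oO sV gV pV nV Oq).
  by rewrite ipZl uw mulr0.
rewrite {1}(null_frame_decomp (nab x u) F) (key e1) ?(key e2) ?(key u) ?FE //.
by rewrite !scale0r !addr0.
Qed.

End PPWaveVector.

(** * Plane waves *)

(* The algebraic content of the plane wave condition along the line of [v].
   The last clause is what provides a parallel field [phi *: v]. *)
Definition plane_wave_vector {R : realType} {n : nat}
    (g : metricLieAlgebra R n) (v : 'rV[R]_n) (lambda : 'rV[R]_n -> R) : Prop :=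
  [/\ [/\ v != 0, ip g v v = 0 & forall x, levi_civita g x v = lambda x *: v],
      forall x y z, ip g x v = 0 -> ip g y v = 0 -> curvature g x y z = 0,
      forall w x y z, ip g w v = 0 -> nabla_curvature g w x y z = 0 &
      (forall x, lambda x = 0) \/ (forall x, g x v = lambda x *: v)].

(** * Transport along homotheties *)

Section HomothetyTransfer.
Context {R : realType} {n : nat} (g h : metricLieAlgebra R n).
Context (f : {linear 'rV[R]_n -> 'rV[R]_n}) (f' : 'rV[R]_n -> 'rV[R]_n).
Hypotheses (fK : cancel f f') (f'K : cancel f' f).
Hypothesis f_bracket : forall x y, f (g x y) = h (f x) (f y).
Context (c : R) (c0 : 0 < c).
Hypothesis f_ip : forall x y, ip h (f x) (f y) = c * ip g x y.

Lemma homothety_levi_civita x y :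
  f (levi_civita g x y) = levi_civita h (f x) (f y).
Proof.
apply/esym/levi_civita_unique => z; rewrite -(f'K z) -!f_bracket !f_ip.
by rewrite mulrCA koszul; ring.
Qed.

Lemma homothety_curvature x y z :
  f (curvature g x y z) = curvature h (f x) (f y) (f z).
Proof. by rewrite /curvature !linearB !homothety_levi_civita f_bracket. Qed.

Local Opaque curvature.

Lemma homothety_nabla_curvature w x y z :
  f (nabla_curvature g w x y z) = nabla_curvature h (f w) (f x) (f y) (f z).
Proof.
rewrite /nabla_curvature 3!linearB homothety_levi_civita.
by rewrite 4!homothety_curvature 3!homothety_levi_civita.
Qed.

Lemma homothety_plane_wave_vector v lambda : plane_wave_vector h v lambda ->
  plane_wave_vector g (f' v) (lambda \o f).
Proof.
move=> [[v0 vv nv] Rv Nv bv].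
have f0 x : f x = 0 -> x = 0 by move=> fx; rewrite -(fK x) fx -[in LHS](linear0 f) fK.
have fip x : ip g x (f' v) = 0 -> ip h (f x) v = 0.
  by move=> xv; rewrite -{1}(f'K v) f_ip xv mulr0.
split; first split.
- by apply: contraNneq v0 => fv; rewrite -(f'K v) fv linear0.
- by apply: (mulfI (lt0r_neq0 c0)); rewrite -f_ip f'K vv mulr0.
- move=> x; apply: (can_inj fK).
  by rewrite homothety_levi_civita linearZ f'K nv.
- move=> x y z xv yv; apply: f0; rewrite homothety_curvature.
  by apply: Rv; exact: fip.
- move=> w x y z wv; apply: f0; rewrite homothety_nabla_curvature.
  by apply: Nv; exact: fip.
case: bv => bv; [left|right] => x /=; first exact: bv.
by apply: (can_inj fK); rewrite f_bracket linearZ f'K bv.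
Qed.

End HomothetyTransfer.

Local Transparent curvature.

(** * Connection and curvature of the models *)

Section ModelGeometry.
Context {R : realType}.
Implicit Types (x y z w : 'rV[R]_4).

Lemma rowNE x k : (- x) 0 k = - x 0 k.
Proof. by rewrite mxE. Qed.

Lemma rowZE (c : R) x k : (c *: x) 0 k = c * x 0 k.
Proof. by rewrite mxE. Qed.

Lemma gram_product (B : 'M[R]_4) x y :
  (x *m B *m y^T) 0 0 =
  \sum_(i < 4) \sum_(j < 4) x 0 (o4 j) * B (o4 j) (o4 i) * y 0 (o4 i).
Proof.
rewrite mxE; apply: eq_bigr => i _; rewrite !mxE mulr_suml.
by apply: eq_bigr => j _; rewrite /o4 !inord_val.
Qed.

Lemma gram_u_product x y : (x *m gram_u *m y^T) 0 0 =
  x 0 (o4 0) * y 0 (o4 1) + x 0 (o4 1) * y 0 (o4 0)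
  + x 0 (o4 2) * y 0 (o4 2) + x 0 (o4 3) * y 0 (o4 3).
Proof.
rewrite gram_product !big_ord_recl !big_ord0 /= !mxE !inordK //=; ring.
Qed.

Lemma gram_v_product x y : (x *m gram_v *m y^T) 0 0 =
  x 0 (o4 0) * y 0 (o4 0) + x 0 (o4 1) * y 0 (o4 1)
  + x 0 (o4 2) * y 0 (o4 3) + x 0 (o4 3) * y 0 (o4 2).
Proof.
rewrite gram_product !big_ord_recl !big_ord0 /= !mxE !inordK //=; ring.
Qed.

Lemma model_ip_u (h : metricLieAlgebra R 4) x y : gram h = gram_u ->
  ip h x y = x 0 (o4 0) * y 0 (o4 1) + x 0 (o4 1) * y 0 (o4 0)
  + x 0 (o4 2) * y 0 (o4 2) + x 0 (o4 3) * y 0 (o4 3).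
Proof. by move=> E; rewrite ipE E gram_u_product. Qed.

Lemma model_ip_v (h : metricLieAlgebra R 4) x y : gram h = gram_v ->
  ip h x y = x 0 (o4 0) * y 0 (o4 0) + x 0 (o4 1) * y 0 (o4 1)
  + x 0 (o4 2) * y 0 (o4 3) + x 0 (o4 3) * y 0 (o4 2).
Proof. by move=> E; rewrite ipE E gram_v_product. Qed.

(** The general connection preserving the line of [v_3], in the frame where [v_1], [v_2], [v_3],
    [v_4] play the roles of [e1], [e2], [u], [m]. *)
Definition null_connection (a w b1 b2 : 'rV[R]_4 -> R) x y : 'rV[R]_4 :=
  row4 (- w x * y 0 (o4 1) + b1 x * y 0 (o4 3))
       (w x * y 0 (o4 0) + b2 x * y 0 (o4 3))
       (- b1 x * y 0 (o4 0) - b2 x * y 0 (o4 1) + a x * y 0 (o4 2))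
       (- a x * y 0 (o4 3)).

(** The curvature of a pp-wave with profile the symmetric screen matrix [h]: R(v_i, v_4) v_4 is the
    sum of the [h_ij v_j] over the screen indices. *)
Definition null_curvature (h11 h12 h22 : R) x y z : 'rV[R]_4 :=
  let d i := x 0 (o4 i) * y 0 (o4 3) - y 0 (o4 i) * x 0 (o4 3) in
  let B1 := h11 * d 0 + h12 * d 1 in let B2 := h12 * d 0 + h22 * d 1 in
  row4 (B1 * z 0 (o4 3)) (B2 * z 0 (o4 3))
    (- B1 * z 0 (o4 0) - B2 * z 0 (o4 1)) 0.

(** With [a t = 0], the derivative of the curvature along [t] is the commutator of the profile with
    a rotation of speed [w t], and the last two hypotheses say that it vanishes. The shear forms
    generate null rotations, which preserve this curvature. *)
Lemma null_nabla_curvature (h : metricLieAlgebra R 4)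
    (a w b1 b2 : 'rV[R]_4 -> R) (h11 h12 h22 : R) t x y z :
  (forall x y, levi_civita h x y = null_connection a w b1 b2 x y) ->
  (forall x y z, curvature h x y z = null_curvature h11 h12 h22 x y z) ->
  a t = 0 -> w t * h12 = 0 -> w t * (h11 - h22) = 0 ->
  nabla_curvature h t x y z = 0.
Proof.
move=> N C a0 w0 w1; rewrite /nabla_curvature !N !C /null_curvature /null_connection a0.
move: (b1 t) (b2 t) (w t) w0 w1 => b c v w0 w1.
apply: row4P; rewrite !(rowDE, rowNE) row0E !row4E.
all: have [v0|v0] := eqVneq v 0; first by rewrite ?v0; ring.
all: have h0 : h12 = 0 by apply: (mulfI v0); rewrite w0 mulr0.
all: have /eqP : h11 - h22 = 0 by apply: (mulfI v0); rewrite w1 mulr0.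
all: rewrite subr_eq0 => /eqP h2.
all: by rewrite ?h0 ?h2; ring.
Qed.

(** Here [[v_1, v_2] = k v_3], with [k = 0] in model 3 and [k = 1], [g8 = g1 + g4] in model 4. *)
Definition model34_connection (k g1 g2 g3 g4 g5 g8 : R) :=
  null_connection (fun x => - g8 * x 0 (o4 3))
   (fun x => (g2 - k / 2) * x 0 (o4 3))
   (fun x => g1 * x 0 (o4 0) + k / 2 * x 0 (o4 1) + g3 * x 0 (o4 3))
   (fun x => - (k / 2) * x 0 (o4 0) + g4 * x 0 (o4 1) + g5 * x 0 (o4 3)).

Lemma model3_levi_civita (g1 g2 g3 g4 g5 g8 : R) x y :
  levi_civita (model3 g1 g2 g3 g4 g5 g8) x y =
  model34_connection 0 g1 g2 g3 g4 g5 g8 x y.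
Proof.
apply: levi_civita_unique => z.
have E : gram (model3 g1 g2 g3 g4 g5 g8) = gram_v by [].
rewrite !(model_ip_v _ _ E) /model34_connection /null_connection /= !row4E !table3E.
by field.
Qed.

Lemma model4_levi_civita (g1 g2 g3 g4 g5 : R) x y :
  levi_civita (model4 g1 g2 g3 g4 g5) x y =
  model34_connection 1 g1 g2 g3 g4 g5 (g1 + g4) x y.
Proof.
apply: levi_civita_unique => z.
have E : gram (model4 g1 g2 g3 g4 g5) = gram_v by [].
rewrite !(model_ip_v _ _ E) /model34_connection /null_connection /= !row4E !table4E.
by field.
Qed.

(** Both off-diagonal entries agree exactly when [k * (g8 - g1 - g4) = 0], which holds in both
    models. *)
Definition model34_curvature (k g1 g2 g3 g4 g5 g8 : R) :=
  null_curvature (g8 * g1 - g1 ^+ 2 + k ^+ 2 / 4)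
    (g8 * (k / 2) + (g2 - k / 2) * g4 - (g2 * g1 + g4 * (k / 2)))
    (g8 * g4 - g4 ^+ 2 + k ^+ 2 / 4).

Lemma model3_curvature (g1 g2 g3 g4 g5 g8 : R) x y z :
  curvature (model3 g1 g2 g3 g4 g5 g8) x y z =
  model34_curvature 0 g1 g2 g3 g4 g5 g8 x y z.
Proof.
rewrite /curvature !model3_levi_civita.
apply: row4P; rewrite /model34_connection /null_connection /model34_curvature
  /null_curvature !(rowDE, rowNE) /= !row4E !table3E; by field.
Qed.

Lemma model4_curvature (g1 g2 g3 g4 g5 : R) x y z :
  curvature (model4 g1 g2 g3 g4 g5) x y z =
  model34_curvature 1 g1 g2 g3 g4 g5 (g1 + g4) x y z.
Proof.
rewrite /curvature !model4_levi_civita.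
apply: row4P; rewrite /model34_connection /null_connection /model34_curvature
  /null_curvature !(rowDE, rowNE) /= !row4E !table4E; by field.
Qed.

Lemma model5_levi_civita (g1 g2 : R) x y :
  levi_civita (model5 g1 g2) x y =
  null_connection (fun=> 0) (fun x => - x 0 (o4 2) - g2 * x 0 (o4 3))
   (fun x => g1 * x 0 (o4 0)) (fun x => g1 * x 0 (o4 1)) x y.
Proof.
apply: levi_civita_unique => z.
have E : gram (model5 g1 g2) = gram_v by [].
rewrite !(model_ip_v _ _ E) /null_connection /= !row4E !table5E.
by field.
Qed.

Lemma model5_curvature (g1 g2 : R) x y z :
  curvature (model5 g1 g2) x y z =
  null_curvature (- g1 ^+ 2) 0 (- g1 ^+ 2) x y z.
Proof.
rewrite /curvature !model5_levi_civita.
apply: row4P; rewrite /null_connection /null_curvature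
  !(rowDE, rowNE) /= !row4E ?table5E; by ring.
Qed.

Definition model2_connection (g2 : R) x y : 'rV[R]_4 :=
  row4 (- g2 * x 0 (o4 3) * y 0 (o4 2) + x 0 (o4 2) * y 0 (o4 3)) 0
   (x 0 (o4 1) * y 0 (o4 3) + g2 * x 0 (o4 3) * y 0 (o4 1))
   (- x 0 (o4 1) * y 0 (o4 2) - x 0 (o4 2) * y 0 (o4 1)).

Lemma model2_levi_civita (g2 : R) x y :
  levi_civita (model2 g2) x y = model2_connection g2 x y.
Proof.
apply: levi_civita_unique => z.
have E : gram (model2 g2) = gram_u by [].
rewrite !(model_ip_u _ _ E) /model2_connection /= !row4E !table2E.
by field.
Qed.

Definition model2_curvature_row (g2 : R) x y z : 'rV[R]_4 :=
  let d i := x 0 (o4 i) * y 0 (o4 1) - y 0 (o4 i) * x 0 (o4 1) in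
  let B1 := d 2%N in let B2 := (2 * g2 - 1) * d 3%N in
  row4 (- B1 * z 0 (o4 2) - B2 * z 0 (o4 3)) 0
    (B1 * z 0 (o4 1)) (B2 * z 0 (o4 1)).

Lemma model2_curvature (g2 : R) x y z :
  curvature (model2 g2) x y z = model2_curvature_row g2 x y z.
Proof.
rewrite /curvature !model2_levi_civita.
apply: row4P; rewrite /model2_connection /model2_curvature_row
  !(rowDE, rowNE) /= !row4E ?table2E; by ring.
Qed.

Lemma row4_neq0 (a b c d : R) (k : nat) : row4 a b c d 0 (o4 k) != 0 ->
  row4 a b c d != 0.
Proof. by apply: contraNneq => ->; rewrite row0E. Qed.

Lemma model2_plane_wave_vector (g2 : R) :
  plane_wave_vector (model2 g2) (row4 1 0 0 0) (fun=> 0).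
Proof.
have E : gram (model2 g2) = gram_u by [].
have I x : ip (model2 g2) x (row4 1 0 0 0) = x 0 (o4 1).
  by rewrite (model_ip_u _ _ E) !row4E; ring.
split; [split| | |by left].
- by apply: (@row4_neq0 _ _ _ _ 0); rewrite row4E oner_eq0.
- by rewrite I row4E.
- move=> x; rewrite model2_levi_civita scale0r.
  by apply: row4P; rewrite /model2_connection !row4E row0E; ring.
- move=> x y z; rewrite !I model2_curvature => x1 y1.
  by apply: row4P; rewrite /model2_curvature_row /= !row4E row0E ?x1 ?y1; ring.
move=> t x y z; rewrite I => t1.
rewrite /nabla_curvature !model2_curvature !model2_levi_civita.
rewrite /model2_curvature_row /model2_connection t1.
by apply: row4P; rewrite !(rowDE, rowNE) /= row0E !row4E; ring.
Qed.

Lemma v_model_plane_wave_vector (h : metricLieAlgebra R 4)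
    (a w b1 b2 : 'rV[R]_4 -> R) (h11 h12 h22 : R) : gram h = gram_v ->
  (forall x y, levi_civita h x y = null_connection a w b1 b2 x y) ->
  (forall x y z, curvature h x y z = null_curvature h11 h12 h22 x y z) ->
  (forall x, x 0 (o4 3) = 0 -> [/\ a x = 0, w x * h12 = 0 & w x * (h11 - h22) = 0]) ->
  (forall x, a x = 0) \/ (forall x, h x (row4 0 0 1 0) = a x *: row4 0 0 1 0) ->
  plane_wave_vector h (row4 0 0 1 0) a.
Proof.
move=> E N C AW D.
have I x : ip h x (row4 0 0 1 0) = x 0 (o4 3).
  by rewrite (model_ip_v _ _ E) !row4E; ring.
split; [split| | |by []].
- by apply: (@row4_neq0 _ _ _ _ 2); rewrite row4E oner_eq0.
- by rewrite I row4E.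
- move=> x; rewrite N.
  by apply: row4P; rewrite /null_connection rowZE !row4E; ring.
- move=> x y z; rewrite !I C => x3 y3.
  by apply: row4P; rewrite /null_curvature /= !row4E row0E ?x3 ?y3; ring.
move=> t x y z; rewrite I => /AW[at0 wt1 wt2].
exact: (null_nabla_curvature x y z N C at0 wt1 wt2).
Qed.

Lemma model3_plane_wave_vector (g1 g2 g3 g4 g5 g8 : R) :
  plane_wave_vector (model3 g1 g2 g3 g4 g5 g8) (row4 0 0 1 0)
    (fun x => - g8 * x 0 (o4 3)).
Proof.
apply: (v_model_plane_wave_vector _ (@model3_levi_civita g1 g2 g3 g4 g5 g8)
  (@model3_curvature g1 g2 g3 g4 g5 g8)) => // [x ->|].
  by rewrite !mulr0 !mul0r.
right=> x; apply: row4P; rewrite rowZE /= !table3E !row4E; ring.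
Qed.

Lemma model4_plane_wave_vector (g1 g2 g3 g4 g5 : R) :
  plane_wave_vector (model4 g1 g2 g3 g4 g5) (row4 0 0 1 0)
    (fun x => - (g1 + g4) * x 0 (o4 3)).
Proof.
apply: (v_model_plane_wave_vector _ (@model4_levi_civita g1 g2 g3 g4 g5)
  (@model4_curvature g1 g2 g3 g4 g5)) => // [x ->|].
  by rewrite !mulr0 !mul0r.
right=> x; apply: row4P; rewrite rowZE /= !table4E !row4E; ring.
Qed.

(** The rotation form is nonzero on [v_3] itself, but the profile is a scalar matrix and thus
    rotation invariant. In models 3 and 4 the profile is arbitrary and instead both forms vanish on
    the orthogonal of [v_3]. *)
Lemma model5_plane_wave_vector (g1 g2 : R) :
  plane_wave_vector (model5 g1 g2) (row4 0 0 1 0) (fun=> 0).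
Proof.
apply: (v_model_plane_wave_vector _ (@model5_levi_civita g1 g2)
  (@model5_curvature g1 g2)) => // [x _|].
  by rewrite subrr !mulr0.
by left.
Qed.

End ModelGeometry.

(** * From an algebraic null vector to a plane wave *)

Section PlaneWaveOfVector.
Context {R : realType} {n : nat} (G : lieGroup R n) (kappa : chart R n G).
Context (kappa_chart : lg_atlas kappa) (kappa_one : cdom kappa 1%g).
Context (g : metricLieAlgebra R n) (g_lie : lie_algebra_of kappa g).
Implicit Types (x y z w v : 'rV[R]_n) (O : set G).

Lemma nabla_in_line v lambda (O : set G) (V : G -> 'rV[R]_n) q x : v != 0 ->
  (forall x, levi_civita g x v = lambda x *: v) -> open O -> smooth_in O V ->
  (forall r, O r -> V r \in <[v]>%VS) -> O q -> nabla kappa g x V q \in <[v]>%VS.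
Proof.
move=> v0 nv oO sV VU Oq.
have [i vi] := row_neq0_coordinate v0.
(* A linear projection onto the line of [v]. It fixes the values of [V] on [O], so the derivatives
   of [V] stay in its range. *)
pose c (t : 'rV[R]_n) : 'rV[R]_n := (t 0 i / v 0 i) *: v.
have lc : linear c.
  by move=> k s t; rewrite /c !mxE scalerA -scalerDl; congr (_ *: _); field.
pose L : {linear 'rV[R]_n -> 'rV[R]_n} := HB.pack c (GRing.isLinear.Build _ _ _ _ c lc).
have cL : continuous L.
  have lci : linear (fun t : 'rV[R]_n => t 0 i / v 0 i : R^o).
    by move=> k s t; rewrite !mxE mulrDl -mulrA.
  pose Li : {linear 'rV[R]_n -> R^o} :=
    HB.pack (fun t : 'rV[R]_n => t 0 i / v 0 i : R^o)
    (GRing.isLinear.Build _ _ _ _ _ lci).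
  move=> t; apply: (@continuous_comp _ _ _ Li (fun k : R => k *: v)).
    exact: row_linear_continuous.
  exact: scalel_continuous.
have LV r : O r -> V r = (L \o V) r.
  move=> /VU /vlineP[k Vk]; rewrite /= /c Vk !mxE.
  by rewrite mulfK.
rewrite /nabla memvD //.
  rewrite (lieder_ext kappa_chart kappa_one x oO Oq LV).
  rewrite (lieder_linear kappa_chart kappa_one x (has_coordinates_row R n) cL oO sV Oq).
  by rewrite /= /c memvZ // memv_line.
have /vlineP[k ->] := VU q Oq.
by rewrite nabZr nv !memvZ // memv_line.
Qed.

Lemma local_parallel_field v lambda p : plane_wave_vector g v lambda ->
  exists (O : set G) (V : G -> 'rV[R]_n),
    [/\ open O, O p, smooth_in O V & generates O V (fun=> <[v]>%VS)] /\
    parallel_on kappa g O V /\ null_on g O V.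
Proof.
move=> [[v0 vv nv] _ _ [l0|bv]].
  exists setT, (cst v); split; first split=> //.
  - exact: openT.
  - by move=> c ac m; exact: (Ck_on_cst m _ v).
  split=> [q x _|q _] //.
  by rewrite /nabla /lieder derive_cst nv l0 scale0r addr0.
have [ O [phi [oO Op sphi phi0 dphi]]] :=
  integrating_factor p kappa_chart kappa_one g_lie v0 bv.
pose s (k : R^o) : 'rV[R]_n := k *: v.
have ls : linear s by move=> k t r; rewrite /s scalerDl scalerA.
pose L : {linear R^o -> 'rV[R]_n} := HB.pack s (GRing.isLinear.Build _ _ _ _ s ls).
have cL : continuous L by move=> k; exact: scalel_continuous.
exists O, (L \o phi); split; first split=> //.
- exact: smooth_in_linear.
- move=> q Oq; have pq := phi0 q Oq; split.
    by rewrite /= /s scaler_eq0 negb_or pq.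
  apply/vspaceP => t; apply/vlineP/vlineP => -[k ->].
    by exists (k / phi q); rewrite /= /s scalerA divfK.
  by exists (k * phi q); rewrite /= /s scalerA.
split=> [q x Oq|q Oq]; last by rewrite /= /s ipZl ipZr vv !mulr0.
rewrite /nabla (lieder_linear kappa_chart kappa_one x (has_coordinates_scalar R) cL oO sphi Oq).
by rewrite dphi //= /s nabZr nv scalerA -scalerDl mulNr mulrC addNr scale0r.
Qed.

Lemma plane_wave_of_vector v lambda : plane_wave_vector g v lambda ->
  plane_wave kappa g.
Proof.
move=> H; have [[v0 vv nv] Rv Nv _] := H.
have orth x : orthogonal_to g <[v]>%VS x -> ip g x v = 0 by apply; exact: memv_line.
exists (fun=> <[v]>%VS); split; last by move=> p w x y z /orth; exact: Nv.
split.
- move=> p; exists setT, (cst v); split=> //; first exact: openT.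
  by move=> c ac m; exact: (Ck_on_cst m _ v).
- by move=> p u /vlineP[k ->]; rewrite ipZl ipZr vv !mulr0.
- move=> O V oO sV VU q x Oq.
  exact: (nabla_in_line x v0 nv oO sV VU Oq).
- by move=> p; exact: (local_parallel_field p H).
- by move=> p x y z /orth xv /orth yv; exact: Rv.
Qed.

Lemma plane_wave_of_homothety (h : metricLieAlgebra R n) v lambda :
  plane_wave_vector h v lambda -> isomorphically_homothetic g h ->
  plane_wave kappa g.
Proof.
move=> H [f [[f' fK f'K] fb [c c0 fi]]].
exact: (plane_wave_of_vector (homothety_plane_wave_vector fK f'K fb c0 fi H)).
Qed.

End PlaneWaveOfVector.

Theorem theorem1p1 (R : realType) (G : lieGroup R 4)
    (kappa : chart R 4 G) (kappa_chart : lg_atlas kappa)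
    (kappa_one : cdom kappa 1%g)
    (g : metricLieAlgebra R 4) (g_lie : lie_algebra_of kappa g) :
  (~ flat g -> pp_wave kappa g ->
    (exists g1 g3 : R,
        g1 != 0 /\ isomorphically_homothetic g (model1 g1 g3)) \/
    (exists g2 : R, isomorphically_homothetic g (model2 g2)) \/
    (exists g1 g2 g3 g4 g5 g8 : R,
        isomorphically_homothetic g (model3 g1 g2 g3 g4 g5 g8)) \/
    (exists g1 g2 g3 g4 g5 : R,
        isomorphically_homothetic g (model4 g1 g2 g3 g4 g5)) \/
    (exists g1 g2 : R,
        g1 != 0 /\ isomorphically_homothetic g (model5 g1 g2))) /\
  (forall g2 : R,
     isomorphically_homothetic g (model2 g2) -> plane_wave kappa g) /\
  (forall g1 g2 g3 g4 g5 g8 : R,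
     isomorphically_homothetic g (model3 g1 g2 g3 g4 g5 g8) ->
     plane_wave kappa g) /\
  (forall g1 g2 g3 g4 g5 : R,
     isomorphically_homothetic g (model4 g1 g2 g3 g4 g5) ->
     plane_wave kappa g) /\
  (forall g1 g2 : R, g1 != 0 ->
     isomorphically_homothetic g (model5 g1 g2) -> plane_wave kappa g).
Proof.
have PW := plane_wave_of_homothety kappa_chart kappa_one g_lie.
split; last split; last split; last split.
- move=> nflat ppw.
  have [u [a PP]] := pp_wave_vector kappa_chart kappa_one g_lie nflat ppw.
  (* Metrics of model 2 are reached through models 3 and 4. *)
  by have [?|[?|[?|?]]] := pp_vector_classification PP nflat;
    [left|right; right; left|right; right; right; left|do 4 right].
- by move=> g2; apply: PW; exact: model2_plane_wave_vector.
- by move=> g1 g2 g3 g4 g5 g8; apply: PW; exact: model3_plane_wave_vector.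
- by move=> g1 g2 g3 g4 g5; apply: PW; exact: model4_plane_wave_vector.
by move=> g1 g2 _; apply: PW; exact: model5_plane_wave_vector.
Qed.
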